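(* Let $A\in\mathcal{A}_{n,1}$ and $\Omega=\Phi(\Lambda(A))$. Then $\overline{\Omega}=\Phi(\Lambda(\overline{A}))$, where $\overline{\Omega}$ is the dual of $\Omega$ (defined in the context).
   Context: An alternating sign matrix (ASM) of order $n$ is an $n\times n$ matrix $A=(a_{ij})$ with entries in $\{-1,0,1\}$ such that in every row and every column the nonzero entries alternate in sign, the first and the last nonzero entries being $1$. $\mathcal{A}_{n,1}$ denotes the set of order-$n$ ASMs having exactly one entry equal to $-1$. For an ASM $A=(a_{ij})$, $\overline{A}=(a_{i,n+1-j})$ is the vertical reflection of $A$. Let $A\in\mathcal{A}_{n,1}$. The opening column is the column containing the unique $-1$; the closing row is the row containing the $-1$; the opening row is the row of the $1$ of the opening column lying above the $-1$. The columns strictly to the left (resp. right) of the opening column form the left side (resp. right side). The closing row contains exactly two $1$'s, one in each side; the one in the right side is the closing $1$ and its column is the closing column. The rows strictly between the opening row and the closing row are the enclosed rows. $A$ is neutral if there are no enclosed rows; otherwise $A$ is positive if the $1$ of the lowest enclosed row lies in the right side, and negative if it lies in the left side. $\mathcal{A}_{n,1}^{+},\mathcal{A}_{n,1}^{0},\mathcal{A}_{n,1}^{-}$ denote the sets of positive, neutral, negative elements of $\mathcal{A}_{n,1}$; $A$ is negative iff $\overline{A}$ is positive. For $A\in\mathcal{A}_{n,1}^{+}\cup\mathcal{A}_{n,1}^{0}$: the charged cell is the intersection of the enclosed rows with the right side; the extended neutral cell is the intersection of the rows from the opening row to the closing row (inclusive) with the left side. The leading $1$ is the highest $1$ in the left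 side strictly below the opening row; its column is the leading column; the leading cell consists of the entries strictly below the opening row and strictly between the leading column and the opening column, and $\ell(A)$ is the sum of its entries. The closing cell consists of the entries strictly below the closing row and strictly between the opening column and the closing column, and $c(A)$ is the sum of its entries; the extended closing cell consists of the entries strictly below the closing row in the columns from the opening column to the closing column inclusive. If $A$ is positive, $E(A)$ is the sum of the entries of the charged cell; if $A$ is neutral, $E(A)=0$. Horizontal displacement: for an $m\times q$ $(0,1)$-matrix $P$ whose nonzero columns are $j_1<\dots<j_t$ with $j_1=1$ and $j_t<q$, $H(P)$ is the $m\times q$ matrix whose column $j_{s+1}$ equals column $j_s$ of $P$ for $1\le s\le t$ (where $j_{t+1}=q$), all other columns being zero. Vertical displacement: for an $m\times q$ $(0,1)$-matrix $P$ whose nonzero rows are $i_1<\dots<i_t$ with $i_1>1$ and $i_t=m$, $V(P)$ is the $m\times q$ matrix whose row $i_{s-1}$ equals row $i_s$ of $P$ for $1\le s\le t$ (where $i_0=1$), all other rows being zero. Partial discharging procedure: for $A\in\mathcal{A}_{n,1}^{+}\cup\mathcal{A}_{n,1}^{0}$, $\delta(A)$ is obtained by applying successively the following steps (all cells, rows and columns referring to the positions they occupy in $A$): (1) replace the $-1$ and the closing $1$ by $0$; (2) replace the submatrix occupying the extended closing cell by its image under $H$; (3) replace the submatrix occupying the extended neutral cell by its image under $V$; (4) lower the entries of the extended neutral cell and of the charged cell by one row: in the left side, for each row $t$ strictly below the opening row up to and including the closing row, the left part of row $t$ becomes the former left part of row $t-1$, and the left part of the opening row becomes zero; in the right side, for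 each row $t$ from two rows below the opening row up to and including the closing row, the right part of row $t$ becomes the former right part of row $t-1$, and the right part of the row immediately below the opening row becomes zero. The complete discharging procedure is $\Delta(A)=(k,\delta(A),c(A),E(A))$, where $k$ is the index of the opening row of $A$. It is known that $\Delta$ is injective on $\mathcal{A}_{n,1}^{+}\cup\mathcal{A}_{n,1}^{0}$, and that whenever $\Delta(A)=(k,P,c,E)$, there is a unique $N\in\mathcal{A}_{n,1}^{+}\cup\mathcal{A}_{n,1}^{0}$ with $\Delta(N)=(k,P,c+E,0)$, and this $N$ is neutral. Neutralizing procedure $\Lambda$: for $A\in\mathcal{A}_{n,1}^{+}\cup\mathcal{A}_{n,1}^{0}$ with $\Delta(A)=(k,P,c,E)$, $\Lambda(A)=(N,E)$ where $N$ is the unique element with $\Delta(N)=(k,P,c+E,0)$. For $A\in\mathcal{A}_{n,1}^{-}$, write $\Lambda(\overline{A})=(M,-E)$ and set $\Lambda(A)=(\overline{M},E)$. $\Lambda$ takes values in $\mathcal{N}_{n,1}=\{(N,E)\,:\,N\in\mathcal{A}_{n,1}^{0},\ E\in\mathbb{Z},\ -\ell(N)\le E\le c(N)\}$. Generalized inversion table: for $(N,E)\in\mathcal{N}_{n,1}$, let $n+1-k$ be the index of the opening row of $N$ (so the closing row is row $n+2-k$). For $1\le i\le n$, $a_i$ is the sum of the entries of $N$ lying strictly below row $n+1-i$ and strictly to the left of the unique $1$ of row $n+1-i$ (for $i=k-1$, i.e. the closing row, the leftmost $1$ of that row is used). Let $b=c(N)$ and $\beta=E+\ell(N)$. The generalized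 inversion table of $(N,E)$ is $(k;a_1,\dots,a_n;b,\beta)$. Mixed configurations: let $\mathcal{G}_n=\{(x,y)\in\mathbb{Z}^2: 0\le x<y\le n\}$. Steps are $E=(1,0)$, $F=(1,0)$ (a distinct letter from $E$ with the same displacement), $S=(0,-1)$, $N=(1,1)$. A mixed path is a lattice path all of whose vertices lie in $\mathcal{G}_n$, given as a word $LR$ where the Left part $L$ is a word in $\{S,E\}$ and the Right part $R$ is a word in $\{F,N\}$; the vertex where $L$ ends and $R$ begins is the junction. An order-$n$ mixed configuration is a sequence $(\omega_1,\dots,\omega_n)$ of mixed paths such that for some permutation $\sigma$ of $\{1,\dots,n\}$, $\omega_i$ starts at $(0,i)$ and ends at $(\sigma(i)-1,\sigma(i))$, the Left parts are pairwise vertex-disjoint, and the Right parts are pairwise vertex-disjoint. $\mathcal{M}_{n,1}$ is the set of order-$n$ mixed configurations containing exactly one $N$-step (hence exactly one $S$-step). For $(N,E)\in\mathcal{N}_{n,1}$ with generalized inversion table $(k;a_1,\dots,a_n;b,\beta)$, $\Phi(N,E)=(\omega_1,\dots,\omega_n)$ where $\omega_i=E^{a_i}F^{i-1-a_i}$ for $i\notin\{k-1,k\}$, $\omega_{k-1}=E^{a_{k-1}}F^{\beta}NF^{k-2-a_{k-1}-\beta}$, and $\omega_k=E^{a_k}SE^{b}F^{k-2-a_k-b}$ (exponents denote repetition of steps; $\omega_i$ starts at $(0,i)$). Duality: for $\Omega\in\mathcal{M}_{n,1}$, its dual $\overline{\Omega}$ is the unique element of $\mathcal{M}_{n,1}$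 such that, with $\rho(x,y)=(y-1-x,y)$, the set of junctions of $\overline{\Omega}$ is the image under $\rho$ of the set of junctions of $\Omega$, the start vertex of the $S$-step of $\overline{\Omega}$ is $\rho$ of the start vertex of the $S$-step of $\Omega$, and the end vertex of the $N$-step of $\overline{\Omega}$ is $\rho$ of the end vertex of the $N$-step of $\Omega$. Equivalently, if $\Omega=\Phi(N,E)$ where $(N,E)$ has generalized inversion table $(k;a_1,\dots,a_n;b,\beta)$, then $\overline{\Omega}$ is given by the formulas defining $\Phi$ applied to $(k;\overline{a}_1,\dots,\overline{a}_n;\overline{b},\overline{\beta})$ with $\overline{a}_i=i-1-a_i$ ($i\ne k-1$), $\overline{a}_{k-1}=k-2-a_k-b$, $\overline{b}=a_k-1-a_{k-1}$, $\overline{\beta}=a_k+b-a_{k-1}-\beta-1$. *)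

(* Defs.v *)
(* Matrices are 1-indexed functions nat -> nat -> int;
   an order-n matrix is the restriction to rows/columns 1..n. *)
From HB Require Import structures.
From mathcomp Require Import all_boot all_order all_algebra.
Set Implicit Arguments. Unset Strict Implicit. Unset Printing Implicit Defensive.
Import Order.TTheory GRing.Theory Num.Theory.

Definition mat := nat -> nat -> int.

Definition inr (n i : nat) : bool := (1 <= i <= n)%N.

Definition mat_eq (n : nat) (A B : mat) : Prop :=
  forall i j, inr n i -> inr n j -> A i j = B i j.

Definition alt_seq (s : seq int) : bool :=
  match s with
  | [::] => false
  | x :: s' => [&& x == 1%R, last x s' == 1%R & path (fun u v => v == (- u)%R) x s']
  end.

Definition row_seq n (A : mat) i : seq int := [seq A i j | j <- iota 1 n].
Definition col_seq n (A : mat) j : seq int := [seq A i j | i <- iota 1 n].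

Definition is_ASM (n : nat) (A : mat) : Prop :=
  (forall i j, inr n i -> inr n j -> A i j \in [:: (-1)%R; 0%R; 1%R]) /\
  (forall i, inr n i -> alt_seq [seq x <- row_seq n A i | x != 0%R]) /\
  (forall j, inr n j -> alt_seq [seq x <- col_seq n A j | x != 0%R]).

Definition nneg (n : nat) (A : mat) : nat :=
  (\sum_(i <- iota 1 n) \sum_(j <- iota 1 n) (A i j == (-1)%R))%N.

Definition in_A1 (n : nat) (A : mat) : Prop := is_ASM n A /\ nneg n A = 1%N.

Definition bar (n : nat) (A : mat) : mat := fun i j => A i (n.+1 - j)%N.

Definition first_in (s : seq nat) (P : pred nat) : nat := head 0%N [seq x <- s | P x].

Definition cell_sum (A : mat) (r1 r2 c1 c2 : nat) : int :=
  (\sum_(r1 <= i < r2.+1) \sum_(c1 <= j < c2.+1) A i j)%R.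

Definition cl_row n (A : mat) : nat :=
  first_in (iota 1 n) (fun i => has (fun j => A i j == (-1)%R) (iota 1 n)).
Definition op_col n (A : mat) : nat :=
  first_in (iota 1 n) (fun j => A (cl_row n A) j == (-1)%R).
Definition op_row n (A : mat) : nat :=
  first_in (iota 1 (cl_row n A).-1) (fun i => A i (op_col n A) == 1%R).
Definition cl_col n (A : mat) : nat :=
  first_in (iota (op_col n A).+1 (n - op_col n A)) (fun j => A (cl_row n A) j == 1%R).

(* column of the leftmost 1 of row i (the unique 1 if the row has no -1) *)
Definition one_col n (A : mat) (i : nat) : nat :=
  first_in (iota 1 n) (fun j => A i j == 1%R).

(* neutral: no enclosed rows *)
Definition is_neutral n (A : mat) : bool := cl_row n A == (op_row n A).+1.
(* positive / negative: the 1 of the lowest enclosed row (row cl_row - 1)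
   lies in the right / left side *)
Definition is_positive n (A : mat) : bool :=
  ((op_row n A).+1 < cl_row n A)%N && (op_col n A < one_col n A (cl_row n A).-1)%N.
Definition is_negative n (A : mat) : bool :=
  ((op_row n A).+1 < cl_row n A)%N && (one_col n A (cl_row n A).-1 < op_col n A)%N.

Definition in_PN (n : nat) (A : mat) : Prop :=
  in_A1 n A /\ (is_positive n A || is_neutral n A).

(* E(A): sum of the charged cell (enclosed rows x right side) if A is
   positive, 0 if A is neutral *)
Definition Echg n (A : mat) : int :=
  if is_positive n A then
    cell_sum A (op_row n A).+1 (cl_row n A).-1 (op_col n A).+1 n
  else 0%R.

Definition lead_row n (A : mat) : nat :=
  first_in (iota (op_row n A).+1 (n - op_row n A))
    (fun i => has (fun j => A i j == 1%R) (iota 1 (op_col n A).-1)).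
Definition lead_col n (A : mat) : nat :=
  first_in (iota 1 (op_col n A).-1) (fun j => A (lead_row n A) j == 1%R).
Definition lval n (A : mat) : int :=
  cell_sum A (op_row n A).+1 n (lead_col n A).+1 (op_col n A).-1.
Definition cval n (A : mat) : int :=
  cell_sum A (cl_row n A).+1 n (op_col n A).+1 (cl_col n A).-1.

Definition colnz (m : nat) (P : mat) (c : nat) : bool :=
  has (fun r => P r c != 0%R) (iota 1 m).
Definition rownz (q : nat) (P : mat) (r : nat) : bool :=
  has (fun c => P r c != 0%R) (iota 1 q).

(* horizontal displacement H of an m x q matrix: column j_{s+1} receives
   column j_s (j_{t+1} = q), other columns are zero *)
Definition Hdisp (m q : nat) (P : mat) : mat := fun r c =>
  let prevs := [seq j <- iota 1 c.-1 | colnz m P j] in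
  if ((c == q) || colnz m P c) && (prevs != [::]) then P r (last 0%N prevs)
  else 0%R.

(* vertical displacement V of an m x q matrix: row i_{s-1} receives row
   i_s (i_0 = 1), other rows are zero *)
Definition Vdisp (m q : nat) (P : mat) : mat := fun r c =>
  let nexts := [seq i <- iota r.+1 (m - r) | rownz q P i] in
  if ((r == 1%N) || rownz q P r) && (nexts != [::]) then P (head 0%N nexts) c
  else 0%R.

Definition subm (A : mat) (r0 c0 : nat) : mat := fun i j => A (i + r0 - 1)%N (j + c0 - 1)%N.
Definition replace (A : mat) (r0 c0 m q : nat) (P : mat) : mat := fun i j =>
  if (r0 <= i < r0 + m)%N && (c0 <= j < c0 + q)%N then P (i - r0 + 1)%N (j - c0 + 1)%N
  else A i j.

Definition delta n (A : mat) : mat :=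
  let cr := cl_row n A in let oc := op_col n A in
  let orow := op_row n A in let cc := cl_col n A in
  let A1 : mat := fun i j =>
    if (i == cr) && ((j == oc) || (j == cc)) then 0%R else A i j in
  (* (2) extended closing cell: rows cr+1..n, columns oc..cc *)
  let m2 := (n - cr)%N in let q2 := (cc - oc).+1 in
  let A2 := replace A1 cr.+1 oc m2 q2 (Hdisp m2 q2 (subm A1 cr.+1 oc)) in
  (* (3) extended neutral cell: rows orow..cr, columns 1..oc-1 *)
  let m3 := (cr - orow).+1 in let q3 := oc.-1 in
  let A3 := replace A2 orow 1 m3 q3 (Vdisp m3 q3 (subm A2 orow 1)) in
  fun i j =>
    if (j < oc)%N then
      (if i == orow then 0%R
       else if (orow < i <= cr)%N then A3 i.-1 j else A3 i j)
    else if (oc < j)%N then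
      (if i == orow.+1 then 0%R
       else if (orow.+1 < i <= cr)%N then A3 i.-1 j else A3 i j)
    else A3 i j.

(* Neutralizing procedure Lambda (as a relation: Lambda(A) = (N,E))     *)

(* for A positive or neutral: Delta(A) = (k,P,c,E), N the element of
   A^+ \cup A^0 with Delta(N) = (k,P,c+E,0) *)
Definition Lambda_PN n (A N : mat) (E : int) : Prop :=
  in_PN n N /\ E = Echg n A /\ op_row n N = op_row n A /\
  mat_eq n (delta n N) (delta n A) /\
  cval n N = (cval n A + Echg n A)%R /\ Echg n N = 0%R.

Definition Lambda n (A N : mat) (E : int) : Prop :=
  if is_negative n A then
    exists M : mat, Lambda_PN n (bar n A) M (- E)%R /\ mat_eq n N (bar n M)
  else Lambda_PN n A N E.

Inductive step := sE | sF | sS | sN.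

Definition step_eqb (s t : step) : bool :=
  match s, t with
  | sE, sE | sF, sF | sS, sS | sN, sN => true | _, _ => false end.
Lemma step_eqP : Equality.axiom step_eqb.
Proof. by case; case; constructor. Qed.
HB.instance Definition _ := hasDecEq.Build step step_eqP.

Definition pt := (int * int)%type.

Definition move (p : pt) (s : step) : pt :=
  match s with
  | sE | sF => ((p.1 + 1)%R, p.2)
  | sS => (p.1, (p.2 - 1)%R)
  | sN => ((p.1 + 1)%R, (p.2 + 1)%R)
  end.

Definition verts (p : pt) (w : seq step) : seq pt := p :: scanl move p w.
Definition endpt (p : pt) (w : seq step) : pt := foldl move p w.

Definition isL (s : step) : bool := (s == sS) || (s == sE).
Definition isR (s : step) : bool := (s == sF) || (s == sN).

Definition lpart (w : seq step) := take (find (fun s => ~~ isL s) w) w.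
Definition rpart (w : seq step) := drop (find (fun s => ~~ isL s) w) w.
Definition wf_word (w : seq step) : bool := all isR (rpart w).

Definition junction (p : pt) (w : seq step) : pt := endpt p (lpart w).
Definition Lverts (p : pt) (w : seq step) := verts p (lpart w).
Definition Rverts (p : pt) (w : seq step) := verts (junction p w) (rpart w).

Definition inG (n : nat) (p : pt) : bool := ((0 <= p.1)%R && (p.1 < p.2)%R && (p.2 <= (Posz n))%R).

Definition startp (i : nat) : pt := (0%R, (Posz i)).

(* a configuration is the list (omega_1,...,omega_n) of words;
   omega_i = nth [::] Om (i-1) starts at (0,i) *)
Definition path_of (Om : seq (seq step)) (i : nat) : seq step := nth [::] Om i.-1.

Definition disj (s t : seq pt) : bool := all (fun p => p \notin t) s.

Definition in_M1 (n : nat) (Om : seq (seq step)) : Prop :=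
  [/\ size Om = n,
      (forall i, inr n i ->
         wf_word (path_of Om i) && all (inG n) (verts (startp i) (path_of Om i))),
      (exists sigma : nat -> nat,
         [/\ forall i, inr n i -> inr n (sigma i),
             forall i j, inr n i -> inr n j -> sigma i = sigma j -> i = j &
             forall i, inr n i ->
               endpt (startp i) (path_of Om i) = ((Posz (sigma i) - 1)%R, Posz (sigma i))]),
      (forall i j, inr n i -> inr n j -> i != j ->
         disj (Lverts (startp i) (path_of Om i)) (Lverts (startp j) (path_of Om j))
         && disj (Rverts (startp i) (path_of Om i)) (Rverts (startp j) (path_of Om j)))
    & (\sum_(i <- iota 1 n) count (pred1 sN) (path_of Om i))%N = 1%N].

Definition junctions (n : nat) (Om : seq (seq step)) (p : pt) : Prop :=
  exists2 i, inr n i & p = junction (startp i) (path_of Om i).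
Definition S_starts (n : nat) (Om : seq (seq step)) (p : pt) : Prop :=
  exists2 i, inr n i & exists2 t, (t < size (path_of Om i))%N &
    nth sE (path_of Om i) t = sS /\ p = nth p (verts (startp i) (path_of Om i)) t.
Definition N_ends (n : nat) (Om : seq (seq step)) (p : pt) : Prop :=
  exists2 i, inr n i & exists2 t, (t < size (path_of Om i))%N &
    nth sE (path_of Om i) t = sN /\ p = nth p (verts (startp i) (path_of Om i)) t.+1.

Definition rho (p : pt) : pt := ((p.2 - 1 - p.1)%R, p.2).

Definition is_dual (n : nat) (Om Om' : seq (seq step)) : Prop :=
  [/\ in_M1 n Om, in_M1 n Om',
      (forall q, junctions n Om' q <-> exists2 p, junctions n Om p & q = rho p),
      (forall q, S_starts n Om' q <-> exists2 p, S_starts n Om p & q = rho p) &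
      (forall q, N_ends n Om' q <-> exists2 p, N_ends n Om p & q = rho p)].

(* int -> nat, negative values truncated to 0 (never used on valid data) *)
Definition tn (z : int) : nat := match z with Posz m => m | Negz _ => 0%N end.

Definition ainv n (N : mat) (i : nat) : int :=
  let r := (n.+1 - i)%N in cell_sum N r.+1 n 1 (one_col n N r).-1.

Definition Phi n (N : mat) (E : int) : seq (seq step) :=
  let k := (n.+1 - op_row n N)%N in
  let a i := tn (ainv n N i) in
  let b := tn (cval n N) in
  let beta := tn (E + lval n N)%R in
  [seq (if i == k.-1 then
          nseq (a i) sE ++ nseq beta sF ++ [:: sN] ++ nseq (k - 2 - a i - beta)%N sF
        else if i == k then
          nseq (a i) sE ++ [:: sS] ++ nseq b sE ++ nseq (k - 2 - a i - b)%N sF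
        else nseq (a i) sE ++ nseq (i - 1 - a i)%N sF)
   | i <- iota 1 n].

(* Main.v *)
(** For [A] with a single -1, [Lambda A] is a neutral matrix [N] with an integer
    [E], and injectivity of [Delta] on neutral matrices shows that [Lambda] of the
    reflection of [A] is the reflection of [N] with [- E].  Injectivity holds because
    [delta] of a neutral matrix only pushes the nonzero columns of the closing cell
    to the right: the number of those columns recovers the closing column, and then
    each column is found at the next nonzero column.  For a neutral [N] the entries
    below the closing row split at the columns [x < y < z] of its three nonzero
    entries into sums [L], [M], [B], [Q] that reflection reverses; the generalized
    inversion table of [N] is read off them, and duality becomes linear arithmetic. *)
From mathcomp Require Import all_boot all_order all_algebra.
From mathcomp Require Import zify.
Require Import Defs.
Set Implicit Arguments. Unset Strict Implicit. Unset Printing Implicit Defensive.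
Import Order.TTheory GRing.Theory Num.Theory.

(** The relation [Lambda] determines its matrix only through the opening row, [delta] and [cval],
    and matrices are functions whose values matter on indices [1..n] only; outputs are therefore
    compared by [mat_eq], and each construction has to be compatible with it. If [A] is not neutral,
    [Lambda] on [A] and on its reflection start from the same positive matrix up to [mat_eq], and
    uniqueness of the output suffices. If [A] is neutral, the two outputs are unrelated a priori,
    and injectivity identifies them with [A] and its reflection.

    The range $-\ell(N) \le E \le c(N)$ is what makes both configurations legal: each bound makes
    one of the two exponents [beta] nonnegative and keeps the Right parts of the other configuration
    disjoint. It is stable under duality because reflection exchanges $\ell$ and $c$ while $E$
    changes sign. *)

(** * Vertices and letters of lattice words *)

Lemma endpt_cat p u v : endpt p (u ++ v) = endpt (endpt p u) v.
Proof. exact: foldl_cat. Qed.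

Lemma endpt_nseq (p : pt) m s : s \notin [:: sS; sN] ->
  endpt p (nseq m s) = ((p.1 + m%:Z)%R, p.2).
Proof.
move=> hs; elim: m p => [|m IH] p /=; first by rewrite addr0; case: p.
by rewrite /endpt /= -/(endpt _ _) IH; case: s hs {IH} => //= _; congr pair; lia.
Qed.

Lemma mem_verts_cat (p : pt) (u v : seq step) (q : pt) :
  q \in verts p (u ++ v) -> q \in verts p u \/ q \in verts (endpt p u) v.
Proof.
rewrite /verts; elim: u p => [|s u IH] p /=; first by right.
rewrite in_cons => /orP[/eqP->|/IH[H|H]].
- by left; rewrite mem_head.
- by left; rewrite in_cons H orbT.
- by right.
Qed.

Lemma mem_verts_nseq (p : pt) m s (q : pt) : s \notin [:: sS; sN] ->
  q \in verts p (nseq m s) -> q.2 = p.2 /\ (p.1 <= q.1 <= p.1 + m%:Z)%R.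
Proof.
move=> hs; elim: m p => [|m IH] p.
  by rewrite /verts /= inE => /eqP->; split=> //; lia.
rewrite /verts /= in_cons => /orP[/eqP->|]; first by split=> //; lia.
case: s hs IH => //= _ IH /IH /= [-> H]; split=> //; lia.
Qed.

Lemma nth_verts q p w t : (t <= size w)%N -> nth q (verts p w) t = endpt p (take t w).
Proof.
rewrite /verts; elim: w p t => [|s w IH] p [|t] //= ht.
exact: IH.
Qed.

Lemma lrpart_cat u v : all isL u -> all isR v -> lpart (u ++ v) = u /\ rpart (u ++ v) = v.
Proof.
move=> hu hv; rewrite /lpart /rpart.
suff -> : find (fun s => ~~ isL s) (u ++ v) = size u.
  by rewrite take_size_cat // drop_size_cat.
rewrite find_cat; have /negbTE-> : ~~ has (fun s => ~~ isL s) u.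
  by rewrite has_predC negbK.
by case: v hv => [|[]] //=; rewrite addn0.
Qed.

Lemma nth_uniq_letter (T : eqType) (s s0 : T) (u v : seq T) t : s \notin u -> s \notin v ->
  (t < size (u ++ s :: v))%N -> nth s0 (u ++ s :: v) t = s -> t = size u.
Proof.
move=> hu hv; rewrite size_cat /= nth_cat => ht.
case: ltnP => h1 h2; first by rewrite -h2 mem_nth in hu.
move: (h1); rewrite leq_eqVlt => /orP[/eqP//|h3].
have E : (t - size u)%N = (t - size u).-1.+1 by lia.
suff : s \in v by rewrite (negbTE hv).
by move: h2; rewrite E /= => <-; rewrite mem_nth //; lia.
Qed.

Lemma notin_nseq (T : eqType) (s t : T) m : s != t -> s \notin nseq m t.
Proof. by move=> h; rewrite mem_nseq negb_and h orbT. Qed.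

(** A single S-step in the whole configuration has a single start, so the set condition of [is_dual]
    becomes an equation between points; [N_endsE] does the same for the N-step. *)
Lemma S_startsE n Om i0 u v p : inr n i0 -> path_of Om i0 = u ++ sS :: v ->
  sS \notin u -> sS \notin v ->
  (forall i, inr n i -> i != i0 -> sS \notin path_of Om i) ->
  S_starts n Om p <-> p = endpt (startp i0) u.
Proof.
move=> hi0 Ew hu hv hother; split.
  case=> i hi [t ht [hS hp]]; have Ei : i = i0.
    by apply/eqP; apply: contraT => /(hother _ hi); rewrite -hS mem_nth.
  move: ht hS hp; rewrite {i hi}Ei Ew => ht hS.
  rewrite nth_verts; last by rewrite ltnW.
  by rewrite (nth_uniq_letter hu hv ht hS) take_size_cat.
move=> ->; exists i0 => //; exists (size u); rewrite Ew.
  by rewrite size_cat /= addnS ltnS leq_addr.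
by rewrite nth_cat ltnn subnn nth_verts ?take_size_cat // size_cat leq_addr.
Qed.

Lemma N_endsE n Om i0 u v p : inr n i0 -> path_of Om i0 = u ++ sN :: v ->
  sN \notin u -> sN \notin v ->
  (forall i, inr n i -> i != i0 -> sN \notin path_of Om i) ->
  N_ends n Om p <-> p = endpt (startp i0) (rcons u sN).
Proof.
move=> hi0 Ew hu hv hother; split.
  case=> i hi [t ht [hS hp]]; have Ei : i = i0.
    by apply/eqP; apply: contraT => /(hother _ hi); rewrite -hS mem_nth.
  move: ht hS hp; rewrite {i hi}Ei Ew => ht hS.
  rewrite nth_verts //.
  by rewrite (nth_uniq_letter hu hv ht hS) -cat_rcons take_size_cat // size_rcons.
move=> ->; exists i0 => //; exists (size u); rewrite Ew.
  by rewrite size_cat /= addnS ltnS leq_addr.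
rewrite nth_cat ltnn subnn nth_verts -?cat_rcons ?take_size_cat ?size_rcons //.
by rewrite size_cat size_rcons leq_addr.
Qed.

(** * Configurations given by a table of natural numbers *)

(** The words of [Phi] are cut at the junction in advance, so that [lrpart_cat] yields their Left
    and Right parts at once. *)
Definition left_word (k : nat) (a : nat -> nat) b (i : nat) :=
  if i == k then nseq (a i) sE ++ sS :: nseq b sE else nseq (a i) sE.

Definition right_word (k : nat) (a : nat -> nat) b beta (i : nat) :=
  if i == k.-1 then nseq beta sF ++ sN :: nseq (k - 2 - a i - beta) sF
  else if i == k then nseq (k - 2 - a i - b) sF else nseq (i - 1 - a i) sF.

Definition config n (k : nat) (a : nat -> nat) (b beta : nat) :=
  [seq left_word k a b i ++ right_word k a b beta i | i <- iota 1 n].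

(** The last three inequalities concern paths [k.-1] and [k] on the line of ordinate [k - 1], the
    only one they share: the junction of path [k] stays inside the region, the Left parts do not
    meet, and the Right parts do not meet. *)
Definition valid_table n (k : nat) (a : nat -> nat) b beta : Prop :=
  [/\ (1 < k <= n)%N,
      forall i, inr n i -> i != k.-1 -> (a i < i)%N,
      (a k + b + 2 <= k)%N, (a k.-1 < a k)%N & (a k.-1 + beta < a k + b)%N].

Lemma path_of_config n (k : nat) a b beta i : inr n i ->
  path_of (config n k a b beta) i = left_word k a b i ++ right_word k a b beta i.
Proof.
move=> /andP[h1 h2]; rewrite /path_of (nth_map 0%N) ?size_iota; last by lia.
by rewrite nth_iota; last lia; rewrite add1n prednK.
Qed.

Lemma lrpart_config n (k : nat) a b beta i : inr n i ->
  lpart (path_of (config n k a b beta) i) = left_word k a b i /\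
  rpart (path_of (config n k a b beta) i) = right_word k a b beta i.
Proof.
move=> hi; rewrite path_of_config //; apply: lrpart_cat.
  by rewrite /left_word; case: ifP => _; rewrite ?all_cat /= !all_nseq ?orbT.
by rewrite /right_word; do 2?case: ifP => _; rewrite ?all_cat /= !all_nseq ?orbT.
Qed.

Lemma junction_config n (k : nat) a b beta i : inr n i ->
  junction (startp i) (path_of (config n k a b beta) i) =
    if i == k then (Posz (a k + b), (Posz k - 1)%R) else (Posz (a i), Posz i).
Proof.
move=> hi; rewrite /junction (lrpart_config _ _ _ _ hi).1 /left_word.
case: eqP => [->|_]; last by rewrite endpt_nseq // /startp /= add0r.
rewrite endpt_cat endpt_nseq //= /endpt /= -/(endpt _ _) endpt_nseq //=.
Qed.

Lemma mem_left_config n (k : nat) a b beta i (q : pt) : inr n i ->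
  q \in Lverts (startp i) (path_of (config n k a b beta) i) ->
  (q.2 = (Posz i) /\ (0 <= q.1 <= Posz (a i))%R) \/
  [/\ i = k, q.2 = (Posz k - 1)%R & (Posz (a k) <= q.1 <= Posz (a k + b))%R].
Proof.
move=> hi; rewrite /Lverts (lrpart_config _ _ _ _ hi).1 /left_word.
case: eqP => [->|_]; last by move/(@mem_verts_nseq _ _ sE _ isT)=> /= ?; left.
case/mem_verts_cat; first by move/(@mem_verts_nseq _ _ sE _ isT)=> /= ?; left.
rewrite endpt_nseq //= /verts /= in_cons => /orP[/eqP->|]; first by left; split=> //=; lia.
by move/(@mem_verts_nseq _ _ sE _ isT)=> /= [? ?]; right; split=> //; lia.
Qed.

(** Vertices are sorted by horizontal line: an ordinary path, path [k.-1] before and after its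
    N-step, path [k]. Disjointness then reduces to linear arithmetic. *)
Lemma mem_right_config n (k : nat) a b beta i (q : pt) : valid_table n k a b beta -> inr n i ->
  q \in Rverts (startp i) (path_of (config n k a b beta) i) ->
  [\/ [/\ i != k, i != k.-1, q.2 = (Posz i) & (Posz (a i) <= q.1 < (Posz i))%R],
      [/\ i = k.-1, q.2 = (Posz k - 1)%R & (Posz (a i) <= q.1 <= Posz (a i + beta))%R],
      [/\ i = k.-1, q.2 = (Posz k) & (Posz (a i + beta + 1) <= q.1 < (Posz k))%R] |
      [/\ i = k, q.2 = (Posz k - 1)%R & (Posz (a k + b) <= q.1 < Posz k - 1)%R]].
Proof.
move=> [hk ha h1 h2 h3] hi.
rewrite /Rverts (lrpart_config _ _ _ _ hi).2 junction_config // /right_word.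
case: (i =P k.-1) => [Ei|Ei].
  have -> : (i == k) = false by lia.
  case/mem_verts_cat => [/(@mem_verts_nseq _ _ sF _ isT) /= [? ?]|].
    by apply: Or42; split=> //; lia.
  rewrite endpt_nseq //= /verts /= in_cons => /orP[/eqP->|].
    by apply: Or42; split=> //=; lia.
  move/(@mem_verts_nseq _ _ sF _ isT) => /= [? ?]; subst i.
  by apply: Or43; split=> //; lia.
case: (i =P k) => [->|Ek] /(@mem_verts_nseq _ _ sF _ isT) /= [? ?].
  by apply: Or44; split=> //; lia.
have := ha _ hi; move/eqP in Ei; rewrite Ei => /(_ isT) ?.
by apply: Or41; split=> //; lia.
Qed.

Lemma verts_LR p w q : q \in verts p w -> q \in Lverts p w \/ q \in Rverts p w.
Proof. by rewrite -{1}(cat_take_drop (find (fun s => ~~ isL s) w) w) => /mem_verts_cat. Qed.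

Lemma config_M1 n (k : nat) a b beta : valid_table n k a b beta -> in_M1 n (config n k a b beta).
Proof.
move=> hv; have [hk ha h1 h2 h3] := hv; split.
- by rewrite size_map size_iota.
- move=> i hi; apply/andP; split.
    rewrite /wf_word (lrpart_config _ _ _ _ hi).2 /right_word.
    by do 2?case: ifP => _; rewrite ?all_cat /= !all_nseq ?orbT.
  apply/allP=> q /verts_LR[/(mem_left_config hi)|/(mem_right_config hv hi)].
    have hi' : (a i < i)%N.
      by have [->|hik] := eqVneq i k.-1; [lia|apply: ha].
    by move: hi; rewrite /inG /inr => hi [[]|[]]; lia.
  by move: hi; rewrite /inG /inr => hi [] [] *; subst; lia.
(* The S-step takes path [k] down to line [k - 1] and the N-step takes path [k.-1] up to line [k],
   so these two endpoints are exchanged. *)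
- exists (fun i => if i == k then k.-1 else if i == k.-1 then k else i); split.
  + by move=> i; rewrite /inr; do 2?case: eqP; lia.
  + by move=> i j; rewrite /inr; do 4?case: eqP; lia.
  move=> i hi; set w := path_of _ _.
  rewrite -{1}(cat_take_drop (find (fun s => ~~ isL s) w) w) /w.
  rewrite endpt_cat -/(lpart _) -/(rpart _) -/(junction _ _) junction_config //.
  rewrite (lrpart_config _ _ _ _ hi).2 /right_word.
  case: (i =P k) => [Ei|Ei].
    have -> : (i == k.-1) = false by lia.
    by rewrite endpt_nseq //=; congr pair; subst i; lia.
  case: (i =P k.-1) => [Ei'|Ei'].
    by rewrite endpt_cat endpt_nseq //= /endpt /= -/(endpt _ _) endpt_nseq //=; congr pair; subst i; lia.
  have := ha _ hi; move/eqP in Ei'; rewrite Ei' => /(_ isT) ?.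
  by rewrite endpt_nseq //=; congr pair; lia.
- move=> i j hi hj hij; apply/andP; split; apply/allP=> q.
    move/(mem_left_config hi) => H1; apply/negP => /(mem_left_config hj) H2.
    case: H1 => [[? ?]|[? ? ?]]; case: H2 => [[? ?]|[? ? ?]]; try lia.
      have ? : i = k.-1 by lia.
      by subst; lia.
    have ? : j = k.-1 by lia.
    by subst; lia.
  move/(mem_right_config hv hi) => H1; apply/negP => /(mem_right_config hv hj) H2.
  by case: H1 => -[] *; case: H2 => -[] *; subst; lia.
- rewrite (bigD1_seq k.-1) ?iota_uniq ?mem_iota //=; last by lia.
  have hk1 : inr n k.-1 by rewrite /inr; lia.
  rewrite path_of_config // /left_word /right_word eqxx.
  have -> : (k.-1 == k) = false by lia.
  rewrite !count_cat /= !count_nseq /= !mul0n big1_seq // => i /andP[hik].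
  rewrite mem_iota => hi; rewrite path_of_config /left_word /right_word; last by rewrite /inr; lia.
  by rewrite (negbTE hik); case: eqP; rewrite !count_cat /= !count_nseq.
Qed.

Lemma junctions_config n (k : nat) a b beta p :
  junctions n (config n k a b beta) p <->
  exists2 i, inr n i &
    p = if i == k then (Posz (a k + b), (Posz k - 1)%R) else (Posz (a i), Posz i).
Proof. by split=> -[i hi ->]; exists i => //; rewrite junction_config. Qed.

Lemma S_starts_config n (k : nat) a b beta p : valid_table n k a b beta ->
  S_starts n (config n k a b beta) p <-> p = (Posz (a k), Posz k).
Proof.
move=> [hk ha h1 h2 h3]; have hk1 : inr n k by rewrite /inr; lia.
rewrite (@S_startsE _ _ k (nseq (a k) sE) (nseq b sE ++ right_word k a b beta k)) //.
- by rewrite endpt_nseq //= add0r.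
- by rewrite path_of_config // /left_word eqxx -catA.
- exact: notin_nseq.
- rewrite mem_cat negb_or notin_nseq //= /right_word eqxx.
  have -> : (k == k.-1) = false by lia.
  exact: notin_nseq.
move=> i hi hik; rewrite path_of_config // /left_word /right_word (negbTE hik).
by case: ifP => _; rewrite !mem_cat ?in_cons !negb_or ?notin_nseq.
Qed.

Lemma N_ends_config n (k : nat) a b beta p : valid_table n k a b beta ->
  N_ends n (config n k a b beta) p <-> p = (Posz (a k.-1 + beta + 1), Posz k).
Proof.
move=> [hk ha h1 h2 h3]; have hk1 : inr n k.-1 by rewrite /inr; lia.
have Ek : (k.-1 == k) = false by lia.
rewrite (@N_endsE _ _ k.-1 (nseq (a k.-1) sE ++ nseq beta sF)
  (nseq (k - 2 - a k.-1 - beta) sF)) //.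
- rewrite -cats1 !endpt_cat !endpt_nseq //= /endpt /=.
  by have -> : ((0 + Posz (a k.-1) + (Posz beta) + 1, Posz k.-1 + 1) =
             (Posz (a k.-1 + beta + 1), Posz k) :> pt)%R by congr pair; lia.
- by rewrite path_of_config // /left_word /right_word eqxx Ek -catA.
- by rewrite mem_cat negb_or !notin_nseq.
- exact: notin_nseq.
move=> i hi hik; rewrite path_of_config // /left_word /right_word (negbTE hik).
by case: ifP => _; rewrite !mem_cat ?in_cons !negb_or ?notin_nseq.
Qed.

(** [rho] preserves horizontal lines, and the line of ordinate [k - 1] carries two junctions, those
    of paths [k.-1] and [k]. Since [rho] reverses their order, it exchanges their roles; every other
    junction stays with its path. This gives the crossed equation for [a' k.-1]. *)
Lemma config_dual n (k : nat) a b beta a' b' beta' :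
  valid_table n k a b beta -> valid_table n k a' b' beta' ->
  (forall i, inr n i -> i != k.-1 -> (a i + a' i = i.-1)%N) ->
  (a' k.-1 + a k + b = k - 2)%N -> (b' + a k.-1 + 1 = a k)%N ->
  (beta' + a k.-1 + beta + 1 = a k + b)%N ->
  is_dual n (config n k a b beta) (config n k a' b' beta').
Proof.
move=> hv hv' ha hk1 hb hbeta; have [hk _ h1 h2 h3] := hv.
have hkn : inr n k by rewrite /inr; lia.
have hkn' : inr n k.-1 by rewrite /inr; lia.
have Ek : (k.-1 == k) = false by lia.
have hak : (a k + a' k = k.-1)%N by apply: ha => //; lia.
split; try exact: config_M1.
- move=> q; rewrite junctions_config; split.
    case=> i hi ->; case: (i =P k) => [Ei|/eqP/negbTE Ei].
      exists (Posz (a k.-1), Posz k.-1).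
        by rewrite junctions_config; exists k.-1; rewrite ?Ek.
      by rewrite /rho /=; congr pair; lia.
    case: (i =P k.-1) => [Ei'|/eqP Ei'].
      exists (Posz (a k + b), (Posz k - 1)%R).
        by rewrite junctions_config; exists k; rewrite ?eqxx.
      by rewrite /rho /= Ei'; congr pair; lia.
    exists (Posz (a i), Posz i).
      by rewrite junctions_config; exists i; rewrite ?Ei.
    by have := ha _ hi Ei'; move: hi; rewrite /rho /inr /= => ? ?; congr pair; lia.
  case=> p; rewrite junctions_config => -[i hi ->] ->; case: (i =P k) => [Ei|/eqP/negbTE Ei].
    exists k.-1 => //; rewrite Ek /rho /=; congr pair; lia.
  case: (i =P k.-1) => [Ei'|/eqP Ei'].
    by exists k => //; rewrite eqxx /rho /= Ei'; congr pair; lia.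
  exists i => //; rewrite Ei.
  by have := ha _ hi Ei'; move: hi; rewrite /rho /inr /= => ? ?; congr pair; lia.
- move=> q; rewrite S_starts_config //; split=> [->|[p]].
    exists (Posz (a k), Posz k); first by rewrite S_starts_config.
    by rewrite /rho /=; congr pair; lia.
  by rewrite S_starts_config // => -> ->; rewrite /rho /=; congr pair; lia.
- move=> q; rewrite N_ends_config //; split=> [->|[p]].
    exists (Posz (a k.-1 + beta + 1), Posz k); first by rewrite N_ends_config.
    by rewrite /rho /=; congr pair; lia.
  by rewrite N_ends_config // => -> ->; rewrite /rho /=; congr pair; lia.
Qed.

(** * Integer sums over intervals *)

(* Naming the sum keeps all its occurrences syntactically equal, whatever
   canonical structure on [int] elaboration picks; [lia] sees it as one atom. *)
Definition nsum (f : nat -> int) (a b : nat) : int := (\sum_(a <= j < b) f j)%R.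

Lemma nsum_geq f a b : (b <= a)%N -> nsum f a b = 0%R.
Proof. by move=> h; rewrite /nsum big_geq. Qed.

Lemma nsum_cat f b a c : (a <= b <= c)%N -> nsum f a c = (nsum f a b + nsum f b c)%R.
Proof. by move=> /andP[? ?]; rewrite /nsum (@big_cat_nat _ _ _ b). Qed.

Lemma nsum_recl f a b : (a < b)%N -> nsum f a b = (f a + nsum f a.+1 b)%R.
Proof. by move=> h; rewrite /nsum big_ltn. Qed.

Lemma nsum_recr f a b : (a <= b)%N -> nsum f a b.+1 = (nsum f a b + f b)%R.
Proof. by move=> h; rewrite /nsum big_nat_recr. Qed.

Lemma nsum1 f a : nsum f a a.+1 = f a.
Proof. by rewrite /nsum big_nat1. Qed.

Lemma eq_nsum f g a b : (forall j, (a <= j < b)%N -> f j = g j) -> nsum f a b = nsum g a b.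
Proof. by move=> h; apply: eq_big_nat. Qed.

Lemma nsum0 f a b : (forall j, (a <= j < b)%N -> f j = 0%R) -> nsum f a b = 0%R.
Proof. by move=> h; rewrite (eq_nsum h) /nsum big1. Qed.

Lemma nsumD f g a b : nsum (fun j => (f j + g j)%R) a b = (nsum f a b + nsum g a b)%R.
Proof. exact: big_split. Qed.

Lemma nsum_exchange (f : nat -> nat -> int) a b c d :
  nsum (fun i => nsum (f i) c d) a b = nsum (fun j => nsum (f^~ j) a b) c d.
Proof. exact: exchange_big. Qed.

Lemma nsum_ge0 f a b : (forall j, (a <= j < b)%N -> 0 <= f j)%R -> (0 <= nsum f a b)%R.
Proof. by move=> h; rewrite /nsum big_nat_cond sumr_ge0 // => j /andP[/h]. Qed.

Lemma cell_sumE A r1 r2 c1 c2 :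
  cell_sum A r1 r2 c1 c2 = nsum (fun i => nsum (A i) c1 c2.+1) r1 r2.+1.
Proof. by []. Qed.

(** * Alternating sequences, prefix sums and searches *)

Definition lsum (s : seq int) : int := (\sum_(t <- s) t)%R.

(** A virtual -1 in front makes the first entry obey the same rule as the others, and the condition
    on [last] then excludes the empty sequence. *)
Lemma alt_seqE (s : seq int) :
  alt_seq s = path (fun u v : int => v == (- u)%R) (-1)%R s && (last (-1)%R s == 1%R).
Proof. by case: s => [|x s] //=; rewrite opprK -andbA; congr andb; rewrite andbC. Qed.

(** A nonzero entry [t] coming after [u] satisfies [t = - u], hence [2t = t - u], and twice the sum
    telescopes. *)
Lemma alt_path_sum (x l : int) (s : seq int) : x = 1%R \/ x = (-1)%R ->
  path (fun u v : int => v == (- u)%R) x [seq t <- s | t != 0%R] ->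
  last x [seq t <- s | t != 0%R] = l ->
  (l = 1%R \/ l = (-1)%R) /\ (lsum s + lsum s = l - x)%R.
Proof.
rewrite /lsum; elim: s x => [|t s IH] x hx /=; first by rewrite big_nil; lia.
rewrite big_cons -/(lsum s); case: eqP => [->|ht] /=; first by rewrite add0r; apply: IH.
case/andP => /eqP Et hp hl; have [] := IH t _ hp hl; first by lia.
by rewrite -/(lsum s) => h1 h2; split=> //; lia.
Qed.

Lemma alt_seq_sum (s : seq int) m : alt_seq [seq t <- s | t != 0%R] ->
  (0 <= lsum (take m s) <= 1)%R /\ lsum s = 1%R.
Proof.
rewrite alt_seqE => /andP[hp /eqP hl]; split; last first.
  by have [|_] := alt_path_sum _ hp hl; [right|lia].
move: hp; rewrite -{1}(cat_take_drop m s) filter_cat cat_path => /andP[hp _].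
by have [|] := alt_path_sum _ hp erefl; [right|lia].
Qed.

Lemma alt_seq_map_sum (f : nat -> int) n c : (c <= n.+1)%N ->
  alt_seq [seq t <- [seq f j | j <- iota 1 n] | t != 0%R] ->
  (0 <= nsum f 1 c <= 1)%R /\ nsum f 1 n.+1 = 1%R.
Proof.
move=> hc /(alt_seq_sum c.-1); rewrite -map_take take_iota /lsum !big_map /nsum /index_iota.
by rewrite subSS subn0 subn1; have /minn_idPl -> : (c.-1 <= n)%N by lia.
Qed.

Lemma nsum_ge (f : nat -> int) a b p :
  (forall j, (a <= j < b)%N -> 0 <= f j)%R -> (a <= p < b)%N -> (f p <= nsum f a b)%R.
Proof.
move=> h hp; rewrite (@nsum_cat f p); last by lia.
rewrite (@nsum_recl f p); last by lia.
have : (0 <= nsum f a p)%R by apply: nsum_ge0 => j ?; apply: h; lia.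
have : (0 <= nsum f p.+1 b)%R by apply: nsum_ge0 => j ?; apply: h; lia.
lia.
Qed.

Lemma nsum_neq0 (f : nat -> int) a b :
  nsum f a b <> 0%R -> exists2 p, (a <= p < b)%N & f p <> 0%R.
Proof.
move=> h; have : has (fun j => f j != 0%R) (index_iota a b).
  apply: contraT; rewrite -all_predC => /allP H; case: h; apply: nsum0 => j hj.
  by apply/eqP; have := H j; rewrite mem_index_iota /= negbK; apply.
by case/hasP => p; rewrite mem_index_iota => hp /eqP; exists p.
Qed.

Lemma nsum_ge2 (f : nat -> int) a b p q :
  (forall j, (a <= j < b)%N -> 0 <= f j)%R -> (a <= p < b)%N -> (p < q < b)%N ->
  (f p + f q <= nsum f a b)%R.
Proof.
move=> h hp hq; rewrite (@nsum_cat f q); last by lia.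
have : (f p <= nsum f a q)%R by apply: nsum_ge => [j ?|]; [apply: h|]; lia.
have : (f q <= nsum f q b)%R by apply: nsum_ge => [j ?|]; [apply: h|]; lia.
lia.
Qed.

Lemma nsum01_unique (f : nat -> int) a b :
  (forall j, (a <= j < b)%N -> f j = 0 \/ f j = 1)%R -> nsum f a b = 1%R ->
  exists p, [/\ (a <= p < b)%N, f p = 1%R &
               forall j, (a <= j < b)%N -> j != p -> f j = 0%R].
Proof.
move=> h01 h1; have [|p hp fp0] := @nsum_neq0 f a b; first by rewrite h1.
have fp1 : f p = 1%R by case: (h01 p hp).
have h0 j : (a <= j < b)%N -> (0 <= f j)%R by case/h01 => ->.
exists p; split=> // j hj hjp; case: (h01 j hj) => // fj.
have [ltjp|ltpj|Ejp] := ltngtP j p; last by rewrite Ejp eqxx in hjp.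
  by have := @nsum_ge2 f a b j p h0; lia.
by have := @nsum_ge2 f a b p j h0; lia.
Qed.

Lemma sum_nat_seq_unique (s : seq nat) (f : nat -> nat) : uniq s ->
  (\sum_(i <- s) f i = 1)%N ->
  exists2 i, i \in s & f i = 1%N /\ forall j, j \in s -> j != i -> f j = 0%N.
Proof.
move=> us h1; have : has (fun j => f j != 0%N) s.
  apply: contraT; rewrite -all_predC => /allP H.
  by move: h1; rewrite big1_seq // => j /= hj; apply/eqP; have := H j hj; rewrite /= negbK.
case/hasP => i hi fi; exists i => //; move: h1; rewrite (bigD1_seq i) //= => h1.
split; first by lia.
move=> j hj hji; have : (\sum_(i0 <- s | i0 != i) f i0)%N = 0%N by lia.
by move/eqP; rewrite sum_nat_seq_eq0 => /allP/(_ j hj); rewrite hji => /eqP.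
Qed.

Lemma nsum_rev (f : nat -> int) n a b : (a <= b <= n.+2)%N ->
  nsum (fun j => f (n.+1 - j)%N) a b = nsum f (n.+2 - b) (n.+2 - a).
Proof.
elim: b => [|b IH] h; first by have -> : a = 0%N by [lia]; rewrite !nsum_geq.
have [->|hab] := eqVneq a b.+1; first by rewrite !nsum_geq.
rewrite nsum_recr /= ?IH; try lia.
have -> : (n.+2 - b.+1 = n.+1 - b)%N by lia.
rewrite [RHS]nsum_recl; last by lia.
by rewrite addrC; have -> : (n.+2 - b = (n.+1 - b).+1)%N by lia.
Qed.

Lemma first_inP (s : seq nat) (P : pred nat) p : p \in s -> P p ->
  first_in s P \in s /\ P (first_in s P).
Proof.
move=> hp Pp; rewrite /first_in; have : p \in [seq x <- s | P x] by rewrite mem_filter Pp.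
case E : [seq x <- s | P x] => [|q t] //= _.
have : q \in [seq x <- s | P x] by rewrite E mem_head.
by rewrite mem_filter => /andP[].
Qed.

Lemma first_in_unique (s : seq nat) (P : pred nat) p : p \in s -> P p ->
  (forall q, q \in s -> P q -> q = p) -> first_in s P = p.
Proof. by move=> hp Pp h; have [] := first_inP hp Pp; apply: h. Qed.

(** Needed where a search can have several hits, as for the two 1's of the closing row and for the
    leading row. *)
Lemma first_in_le a m (P : pred nat) p : p \in iota a m -> P p ->
  (first_in (iota a m) P <= p)%N.
Proof.
elim: m a => [|m IH] a //; rewrite in_cons /first_in /= => /orP[/eqP-> ->//|hp Pp].
case: ifP => _ /=; first by move: hp; rewrite mem_iota; lia.
exact: IH.
Qed.

Lemma eq_in_first_in (s : seq nat) (P Q : pred nat) :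
  {in s, P =1 Q} -> first_in s P = first_in s Q.
Proof. by move=> h; rewrite /first_in (eq_in_filter h). Qed.

(** * Matrices with a single -1, their distinguished positions and their reflection *)

(* [r], [y] : closing row and opening column, i.e. the position of the -1;
   [o] : opening row; [x] < [y] < [z] : columns of the nonzero entries of the
   closing row. *)
Record asm1 (n : nat) (A : mat) (r y o x z : nat) : Prop := Asm1 {
  asm_o : (0 < o < r)%N;
  asm_r : (r <= n)%N;
  asm_x : (0 < x < y)%N;
  asm_z : (y < z <= n)%N;
  asm_01 : forall i j, inr n i -> inr n j -> (i != r) || (j != y) ->
             A i j = 0%R \/ A i j = 1%R;
  asm_ry : A r y = (-1)%R;
  asm_oy : A o y = 1%R;
  asm_rx : A r x = 1%R;
  asm_rz : A r z = 1%R;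
  asm_col0 : forall i, (0 < i < r)%N -> i != o -> A i y = 0%R;
  asm_row0 : forall j, inr n j -> j != x -> j != y -> j != z -> A r j = 0%R;
  asm_row : forall i, inr n i -> nsum (A i) 1 n.+1 = 1%R;
  asm_rowp : forall i c, inr n i -> (c <= n.+1)%N -> (0 <= nsum (A i) 1 c <= 1)%R;
  asm_col : forall j, inr n j -> nsum (A^~ j) 1 n.+1 = 1%R;
  asm_coly : nsum (A^~ y) r.+1 n.+1 = 1%R }.

(** In row [r] the prefix sums just before and just after the -1 both lie in {0, 1}, so they are 1
    and 0: each side of the -1 contains exactly one 1. The same argument in column [y] gives [o]
    above the -1 and the sum 1 below it. *)
Lemma in_A1_asm1 n A : in_A1 n A -> exists r y o x z, asm1 n A r y o x z.
Proof.
move=> [[h01 [hrow hcol]]]; rewrite /nneg => hneg.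
have [r hr [hr1 hr0]] := sum_nat_seq_unique (iota_uniq 1 n) hneg.
have [y hy [hy1 hy0]] := sum_nat_seq_unique (iota_uniq 1 n) hr1.
have {hy1} Ary : A r y = (-1)%R by move: hy1; case: eqP.
have Hr i c : inr n i -> (c <= n.+1)%N ->
    (0 <= nsum (A i) 1 c <= 1)%R /\ nsum (A i) 1 n.+1 = 1%R.
  by move=> hi hc; apply: alt_seq_map_sum (hrow i hi).
have Hc j c : inr n j -> (c <= n.+1)%N ->
    (0 <= nsum (A^~ j) 1 c <= 1)%R /\ nsum (A^~ j) 1 n.+1 = 1%R.
  by move=> hj hc; apply: alt_seq_map_sum (hcol j hj).
have A01 i j : inr n i -> inr n j -> (i != r) || (j != y) -> A i j = 0%R \/ A i j = 1%R.
  move=> hi hj hij; have := h01 i j hi hj; rewrite !inE => /or3P[]/eqP H; [|by left|by right].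
  have mi : i \in iota 1 n by rewrite mem_iota; move: hi; rewrite /inr; lia.
  have mj : j \in iota 1 n by rewrite mem_iota; move: hj; rewrite /inr; lia.
  have [Ei|Ni] := eqVneq i r.
    move: hij; rewrite Ei eqxx /= => /(hy0 j mj); by rewrite -Ei H eqxx.
  by move/eqP: (hr0 i mi Ni); rewrite sum_nat_seq_eq0 => /allP/(_ j mj); rewrite H eqxx.
move: hr hy; rewrite !mem_iota => hr hy.
have ir : inr n r by rewrite /inr; lia.
have iy : inr n y by rewrite /inr; lia.
have yl : nsum (A r) 1 y = 1%R.
  have [|h1 _] := Hr r y ir; first by lia.
  have [|h2 _] := Hr r y.+1 ir; first by lia.
  by move: h2; rewrite nsum_recr ?Ary; lia.
have yr : nsum (A r) y.+1 n.+1 = 1%R.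
  have := (Hr r 0%N ir isT).2; rewrite (@nsum_cat _ y) ?(@nsum_recl _ y) ?Ary; lia.
have xl : nsum (A^~ y) 1 r = 1%R.
  have [|h1 _] := Hc y r iy; first by lia.
  have [|h2 _] := Hc y r.+1 iy; first by lia.
  by move: h2; rewrite nsum_recr ?Ary; lia.
have xr : nsum (A^~ y) r.+1 n.+1 = 1%R.
  have := (Hc y 0%N iy isT).2; rewrite (@nsum_cat _ r) ?(@nsum_recl _ r) ?Ary; lia.
have [|x [hx Ax x0]] := nsum01_unique _ yl.
  by move=> j hj; apply: A01; rewrite /inr; lia.
have [|z [hz Az z0]] := nsum01_unique _ yr.
  by move=> j hj; apply: A01; rewrite /inr; lia.
have [|o [ho Ao o0]] := nsum01_unique _ xl.
  by move=> j hj; apply: A01; rewrite /inr; lia.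
exists r, y, o, x, z; split=> //; try lia.
- move=> j hj jx jy jz; have [lt|gt|E] := ltngtP j y; last by rewrite E eqxx in jy.
    by apply: x0 => //; move: hj; rewrite /inr; lia.
  by apply: z0 => //; move: hj; rewrite /inr; lia.
- by move=> i hi; have [] := Hr i 0%N hi isT.
- by move=> i c hi hc; have [] := Hr i c hi hc.
- by move=> j hj; have [] := Hc j 0%N hj isT.
Qed.

Lemma asm1_bar n A r y o x z : asm1 n A r y o x z ->
  asm1 n (bar n A) r (n.+1 - y) o (n.+1 - z) (n.+1 - x).
Proof.
case=> ho hr hx hz h01 Ary Aoy Arx Arz c0 r0 hrow hrowp hcol hcoly.
have K j : (j <= n)%N -> (n.+1 - (n.+1 - j))%N = j by lia.
split; rewrite /bar ?K //; try lia.
- by move=> i j hi hj hij; apply: h01 => //; move: hj hij; rewrite /inr; lia.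
- by move=> j hj *; apply: r0; move: hj; rewrite /inr; lia.
- by move=> i hi; rewrite nsum_rev ?leqnSn //; rewrite subSnn subn1; apply: hrow.
- move=> i c hi hc; case: c hc => [|c] hc; first by rewrite nsum_geq.
  (* A prefix of the reflected row is a suffix of the original one, that is, 1 minus a prefix. *)
  rewrite nsum_rev; last by lia.
  have := hrow i hi; rewrite (@nsum_cat _ (n.+2 - c.+1)%N); last by lia.
  by have := hrowp i (n.+2 - c.+1)%N hi; rewrite subn1 /=; lia.
- by move=> j hj; apply: hcol; move: hj; rewrite /inr; lia.
Qed.

Lemma asm1_eq n A B r y o x z : mat_eq n A B -> asm1 n A r y o x z -> asm1 n B r y o x z.
Proof.
move=> E; case=> ho hr hx hz h01 Ary Aoy Arx Arz c0 r0 hrow hrowp hcol hcoly.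
split=> //; rewrite -?E //; try (by rewrite /inr; lia).
- by move=> i j hi hj hij; rewrite -E //; apply: h01.
- by move=> i hi hio; rewrite -E; [exact: c0| |]; rewrite /inr; lia.
- by move=> j hj *; rewrite -E //; [exact: r0|rewrite /inr; lia].
- move=> i hi; rewrite -(hrow i hi); apply: eq_nsum => j hj.
  by rewrite E // /inr; lia.
- move=> i c hi hc; have := hrowp i c hi hc.
  suff -> : nsum (A i) 1 c = nsum (B i) 1 c by [].
  by apply: eq_nsum => j hj; rewrite E // /inr; lia.
- move=> j hj; rewrite -(hcol j hj); apply: eq_nsum => i hi.
  by rewrite E // /inr; lia.
- rewrite -hcoly; apply: eq_nsum => i hi.
  by rewrite E // /inr; lia.
Qed.

Lemma asm1_cl_row n A r y o x z : asm1 n A r y o x z -> cl_row n A = r.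
Proof.
move=> H; have := asm_o H; have := asm_r H; have := asm_x H; have := asm_z H => ? ? ? ?.
apply: first_in_unique; first by rewrite mem_iota; lia.
  by apply/hasP; exists y; [rewrite mem_iota; lia|rewrite (asm_ry H)].
move=> i; rewrite mem_iota => hi /hasP[j]; rewrite mem_iota => hj /eqP E.
apply/eqP; apply: contraT => hir.
by have [] := asm_01 H (i := i) (j := j); rewrite ?hir /inr ?E //; lia.
Qed.

Lemma asm1_op_col n A r y o x z : asm1 n A r y o x z -> op_col n A = y.
Proof.
move=> H; have := asm_o H; have := asm_r H; have := asm_x H; have := asm_z H => ? ? ? ?.
rewrite /op_col (asm1_cl_row H).
apply: first_in_unique; first by rewrite mem_iota; lia.
  by rewrite (asm_ry H).
move=> j; rewrite mem_iota => hj /eqP E.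
apply/eqP; apply: contraT => hjy.
by have [] := asm_01 H (i := r) (j := j); rewrite ?hjy ?orbT /inr ?E //; lia.
Qed.

Lemma asm1_op_row n A r y o x z : asm1 n A r y o x z -> op_row n A = o.
Proof.
move=> H; have := asm_o H; have := asm_r H; have := asm_x H; have := asm_z H => ? ? ? ?.
rewrite /op_row (asm1_op_col H) (asm1_cl_row H).
apply: first_in_unique; first by rewrite mem_iota; lia.
  by rewrite (asm_oy H).
move=> i; rewrite mem_iota => hi /eqP E; apply/eqP; apply: contraT => hio.
by rewrite (asm_col0 H) // in E; lia.
Qed.

Lemma asm1_cl_col n A r y o x z : asm1 n A r y o x z -> cl_col n A = z.
Proof.
move=> H; have := asm_o H; have := asm_r H; have := asm_x H; have := asm_z H => ? ? ? ?.
rewrite /cl_col (asm1_op_col H) (asm1_cl_row H).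
apply: first_in_unique; first by rewrite mem_iota; lia.
  by rewrite (asm_rz H).
move=> j; rewrite mem_iota => hj /eqP E; apply/eqP; apply: contraT => hjz.
by rewrite (asm_row0 H) // /inr in E; lia.
Qed.

Lemma asm1_one_col_cl n A r y o x z : asm1 n A r y o x z -> one_col n A r = x.
Proof.
move=> H; have := asm_o H; have := asm_r H; have := asm_x H; have := asm_z H => ? ? ? ?.
have mx : x \in iota 1 n by rewrite mem_iota; lia.
have Px : A r x == 1%R by rewrite (asm_rx H).
have := @first_in_le 1 n (fun j => A r j == 1%R) x mx Px.
have [] := @first_inP (iota 1 n) (fun j => A r j == 1%R) x mx Px.
rewrite -/(one_col n A r) mem_iota; set q := one_col n A r => hq /eqP Aq hqx.
apply/eqP; apply: contraT => hne.
by rewrite (asm_row0 H) // /inr in Aq; lia.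
Qed.

Lemma asm1_one_col n A r y o x z i : asm1 n A r y o x z -> inr n i -> i != r ->
  [/\ inr n (one_col n A i), A i (one_col n A i) = 1%R &
      forall j, inr n j -> j != one_col n A i -> A i j = 0%R].
Proof.
move=> H hi hir; have [|p [hp Ap p0]] := nsum01_unique _ (asm_row H hi).
  by move=> j hj; apply: (asm_01 H) => //; rewrite hir.
suff -> : one_col n A i = p by split=> // j hj; apply: p0.
apply: first_in_unique; first by rewrite mem_iota; lia.
  by rewrite Ap.
move=> j; rewrite mem_iota => hj /eqP E; apply/eqP; apply: contraT => hjp.
by rewrite p0 // in E; lia.
Qed.

Lemma asm1_one_col_bar n A r y o x z i : asm1 n A r y o x z -> inr n i -> i != r ->
  one_col n (bar n A) i = (n.+1 - one_col n A i)%N.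
Proof.
move=> H hi hir; have [/andP[p1 p2] Ap p0] := asm1_one_col H hi hir.
set p := one_col n A i in p1 p2 Ap p0 *.
have Ep : (n.+1 - (n.+1 - p))%N = p by lia.
have [_ _ q0] := asm1_one_col (asm1_bar H) hi hir.
apply/eqP; apply: contraT; rewrite eq_sym => /q0; rewrite /bar Ep Ap => h.
by suff /h : inr n (n.+1 - p) by []; rewrite /inr; lia.
Qed.

(** Column [y] vanishes in the enclosed rows, so the 1 of such a row lies strictly on one side; this
    is why a matrix with enclosed rows is either positive or negative. *)
Lemma asm1_op_col_enclosed n A r y o x z i : asm1 n A r y o x z -> (o < i < r)%N ->
  one_col n A i != y.
Proof.
move=> H hi; have := asm_r H; have := asm_o H => ? ?.
have [||_ Ap _] := asm1_one_col (i := i) H; [by rewrite /inr; lia|by lia|].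
apply/negP => /eqP E; rewrite E (asm_col0 H) // in Ap; lia.
Qed.

Lemma asm1_is_neutral n A r y o x z : asm1 n A r y o x z -> is_neutral n A = (r == o.+1).
Proof. by move=> H; rewrite /is_neutral (asm1_cl_row H) (asm1_op_row H). Qed.

Lemma asm1_is_negative_bar n A r y o x z : asm1 n A r y o x z ->
  is_negative n (bar n A) = is_positive n A.
Proof.
move=> H; have H' := asm1_bar H; rewrite /is_negative /is_positive.
rewrite (asm1_cl_row H) (asm1_cl_row H') (asm1_op_row H) (asm1_op_row H').
rewrite (asm1_op_col H) (asm1_op_col H'); case: ltnP => //= hr.
have := asm_r H; have := asm_o H; have := asm_x H; have := asm_z H => ? ? ? ?.
have hi : inr n r.-1 by rewrite /inr; lia.
have hir : r.-1 != r by lia.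
rewrite (asm1_one_col_bar H hi hir).
by have [/andP[? ?] _ _] := asm1_one_col H hi hir; lia.
Qed.

Lemma asm1_trichotomy n A r y o x z : asm1 n A r y o x z ->
  [\/ is_negative n A /\ is_positive n A = false,
      is_negative n A = false /\ is_positive n A |
      [/\ is_negative n A = false, is_positive n A = false & r = o.+1]].
Proof.
move=> H; have := asm_r H; have := asm_o H => ? ?.
rewrite /is_negative /is_positive (asm1_cl_row H) (asm1_op_row H) (asm1_op_col H).
case: (ltnP o.+1 r) => hr /=; last by apply: Or33; split=> //; lia.
have := asm1_op_col_enclosed (i := r.-1) H.
have -> : (o < r.-1 < r)%N by lia.
move=> /(_ isT); case: ltngtP => // _ _; first by apply: Or31.
by apply: Or32.
Qed.

(** * Sums of entries below a given row *)

(** The column range is half-open, so that cuts at [x], [y], [z] are additive and a single column is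
    the range from [c] to [c.+1]. *)
Definition below (A : mat) (n t c d : nat) : int :=
  nsum (fun i => nsum (A i) c d) t.+1 n.+1.

Lemma below_cat A n t c e d : (c <= e <= d)%N ->
  below A n t c d = (below A n t c e + below A n t e d)%R.
Proof. by move=> h; rewrite /below -nsumD; apply: eq_nsum => i _; apply: nsum_cat. Qed.

Lemma below_col A n t c : below A n t c c.+1 = nsum (A^~ c) t.+1 n.+1.
Proof. by apply: eq_nsum => i _; rewrite nsum1. Qed.

Lemma below_recl A n t c d : (t < n)%N ->
  below A n t c d = (nsum (A t.+1) c d + below A n t.+1 c d)%R.
Proof. by move=> h; rewrite /below nsum_recl. Qed.

Lemma below_bar n A t c d : (0 < c <= d)%N -> (d <= n.+1)%N ->
  below (bar n A) n t c d = below A n t (n.+2 - d) (n.+2 - c).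
Proof. by move=> h1 h2; apply: eq_nsum => i _; rewrite /bar nsum_rev; lia. Qed.

Section OneNegative.
Variables (n : nat) (A : mat) (r y o x z : nat).
Hypothesis H : asm1 n A r y o x z.

Let ho := asm_o H.
Let hr := asm_r H.
Let hx := asm_x H.
Let hz := asm_z H.

Lemma asm_ge0 i j : inr n i -> inr n j -> (i != r) || (j != y) -> (0 <= A i j)%R.
Proof. by move=> hi hj hij; case: (asm_01 H hi hj hij) => ->. Qed.

Lemma below_total t : (t <= n)%N -> below A n t 1 n.+1 = (Posz n - Posz t)%R.
Proof.
move=> ht; rewrite -(subKn ht); elim: (n - t)%N (leq_subr t n) => [|m IH] hm.
  by rewrite /below nsum_geq; lia.
have := @below_recl A n (n - m.+1) 1 n.+1; rewrite (asm_row H); last by rewrite /inr; lia.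
have -> : (n - m.+1).+1 = (n - m)%N by lia.
by rewrite IH; lia.
Qed.

(** The argument goes by prefix sums of rows and not by entries, since the region may contain the
    -1. *)
Lemma below_prefix_ge0 t c : (c <= n.+1)%N -> (0 <= below A n t 1 c)%R.
Proof.
move=> hc; apply: nsum_ge0 => i hi; have ii : inr n i by rewrite /inr; lia.
by have /andP[] := asm_rowp H ii hc.
Qed.

Lemma below_suffix_ge0 t c : (0 < c <= n.+1)%N -> (0 <= below A n t c n.+1)%R.
Proof.
move=> hc; apply: nsum_ge0 => i hi; have ii : inr n i by rewrite /inr; lia.
have := @asm_row _ _ _ _ _ _ _ H i ii; have := @asm_rowp _ _ _ _ _ _ _ H i c ii.
by rewrite (@nsum_cat _ c 1 n.+1); lia.
Qed.

Lemma below_ge0 t c d : (r <= t)%N -> (0 < c)%N -> (d <= n.+1)%N -> (0 <= below A n t c d)%R.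
Proof.
move=> ht hc hd; apply: nsum_ge0 => i hi; apply: nsum_ge0 => j hj.
by apply: asm_ge0; rewrite /inr; lia.
Qed.

(** The column has total 1 (for column [y], already below the -1), the other entries counted are
    nonnegative, and the 1 in row [t] exhausts the total. *)
Lemma col_below0 t j : inr n t -> inr n j -> (j != y) || (r < t)%N -> A t j = 1%R ->
  nsum (A^~ j) t.+1 n.+1 = 0%R.
Proof.
rewrite /inr => ht hj hty At.
have h0 : (0 <= nsum (A^~ j) t.+1 n.+1)%R.
  by apply: nsum_ge0 => i hi; apply: asm_ge0; rewrite /inr; lia.
have [Ej|Nj] := eqVneq j y.
  have hrt : (r < t)%N by move: hty; rewrite Ej eqxx.
  have := asm_coly H; rewrite -Ej (@nsum_cat _ t) ?(@nsum_recl _ t) /=; try lia.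
  have : (0 <= nsum (A^~ j) r.+1 t)%R.
    by apply: nsum_ge0 => i hi; apply: asm_ge0; rewrite /inr; lia.
  lia.
have := @asm_col _ _ _ _ _ _ _ H j hj; rewrite (@nsum_cat _ t) ?(@nsum_recl _ t) /=; try lia.
have : (0 <= nsum (A^~ j) 1 t)%R.
  by apply: nsum_ge0 => i hi; apply: asm_ge0; rewrite /inr; lia.
lia.
Qed.

Lemma one_col_op : one_col n A o = y.
Proof.
have [||_ _ h0] := asm1_one_col (i := o) H; [by rewrite /inr; lia|lia|].
apply/eqP; apply: contraT; rewrite eq_sym => /h0 E.
by have := asm_oy H; rewrite E // /inr; lia.
Qed.

(** Makes the column of the 1 of row [t] drop out of the sum below [t]. The delicate case is the
    opening row: below it, column [y] contributes -1 and then 1. *)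
Lemma col_below_one t : inr n t -> t != r -> r = o.+1 ->
  nsum (A^~ (one_col n A t)) t.+1 n.+1 = 0%R.
Proof.
move=> ht htr Er; have [hp Ap _] := asm1_one_col H ht htr.
have [E|N] := eqVneq (one_col n A t) y; last by apply: col_below0; rewrite ?N.
have [Eo|No] := eqVneq t o.
  rewrite E Eo nsum_recl -?Er; last by lia.
  by rewrite (asm_ry H) (asm_coly H).
have [lt|ge] := ltnP r t; first by apply: col_below0; rewrite ?lt ?orbT.
by rewrite E (asm_col0 H) // in Ap; move: ht; rewrite /inr; lia.
Qed.

Lemma ainvE i : inr n i -> (n.+1 - i != r)%N ->
  ainv n A i = below A n (n.+1 - i) 1 (one_col n A (n.+1 - i)).
Proof.
move=> hi hir; have [|/andP[? ?] _ _] := asm1_one_col H _ hir.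
  by move: hi; rewrite /inr; lia.
by rewrite /ainv cell_sumE prednK.
Qed.

Lemma ainv_clE : ainv n A (n.+1 - r) = below A n r 1 x.
Proof.
rewrite /ainv cell_sumE; have -> : (n.+1 - (n.+1 - r))%N = r by lia.
by rewrite (asm1_one_col_cl H) prednK //; lia.
Qed.

Lemma cvalE : cval n A = below A n r y.+1 z.
Proof.
by rewrite /cval cell_sumE (asm1_cl_row H) (asm1_op_col H) (asm1_cl_col H) prednK //; lia.
Qed.

Lemma cval_ge0 : (0 <= cval n A)%R.
Proof. by rewrite cvalE; apply: below_ge0; lia. Qed.

(** Without enclosed rows the closing row comes right after the opening row, and its 1 in column [x]
    makes it the leading row. It vanishes strictly between [x] and [y], so only the rows below it
    contribute. *)
Lemma lvalE : r = o.+1 -> lval n A = below A n r x.+1 y.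
Proof.
move=> Er; have El : lead_row n A = r.
  rewrite /lead_row (asm1_op_row H) (asm1_op_col H).
  set P := fun i => _; have mr : r \in iota o.+1 (n - o) by rewrite mem_iota; lia.
  have Pr : P r.
    by apply/hasP; exists x; [rewrite mem_iota; lia|rewrite (asm_rx H)].
  have := first_in_le mr Pr; have [] := first_inP mr Pr.
  by rewrite mem_iota; lia.
have Ec : lead_col n A = x.
  rewrite /lead_col El (asm1_op_col H); apply: first_in_unique.
  - by rewrite mem_iota; lia.
  - by rewrite (asm_rx H).
  move=> j; rewrite mem_iota => hj /eqP E; apply/eqP; apply: contraT => hjx.
  by rewrite (asm_row0 H) // /inr in E; lia.
rewrite /lval Ec (asm1_op_row H) (asm1_op_col H) cell_sumE prednK; last by lia.
rewrite -/(below A n o x.+1 y) below_recl -?Er; last by lia.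
by rewrite nsum0 ?add0r // => j hj; apply: (asm_row0 H); rewrite /inr; lia.
Qed.

End OneNegative.

(** * The inversion table of a neutral matrix and of its reflection *)

(** With [k = n.+1 - o], index [k] stands for the opening row [o] and index [k.-1] for the closing
    row [o.+1]. *)
Lemma Phi_config n A y o x z E : asm1 n A o.+1 y o x z -> Phi n A E =
  config n (n.+1 - o) (fun i => tn (ainv n A i)) (tn (cval n A)) (tn (E + lval n A)%R).
Proof.
move=> H; have := asm_o H; have := asm_r H => ? ?; rewrite /Phi /config (asm1_op_row H); apply: eq_map => i.
rewrite /left_word /right_word; case: (i =P (n.+1 - o).-1) => [->|_].
  by have -> : ((n.+1 - o).-1 == n.+1 - o)%N = false by lia.
by case: ifP => // _; rewrite -catA.
Qed.

Section Neutral.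
Variables (n : nat) (A : mat) (y o x z : nat).
Hypothesis H : asm1 n A o.+1 y o x z.

Let ho := asm_o H.
Let hr := asm_r H.
Let hx := asm_x H.
Let hz := asm_z H.
Let H' := asm1_bar H.

(** The rows below row [n.+1 - i] sum to [i.-1]; the two table entries count the parts to the left
    and to the right of the 1 of that row, and the column of this 1 contributes 0. *)
Lemma ainv_bar i : inr n i -> i != (n - o)%N ->
  [/\ 0 <= ainv n A i, 0 <= ainv n (bar n A) i &
      ainv n A i + ainv n (bar n A) i = Posz i.-1]%R.
Proof.
rewrite /inr => hi hik; have hir : (n.+1 - i != o.+1)%N by lia.
have ht : inr n (n.+1 - i) by rewrite /inr; lia.
rewrite (ainvE H) // (ainvE H') // (asm1_one_col_bar H) //.
have := col_below_one H ht hir erefl.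
have [/andP[hp1 hp2] _ _] := asm1_one_col H ht hir.
set t := (n.+1 - i)%N in ht *; set p := one_col n A t in hp1 hp2 *.
rewrite below_bar //; try lia.
have -> : (n.+2 - (n.+1 - p) = p.+1)%N by lia.
rewrite subn1 /= -below_col => h0; split.
- by apply: (below_prefix_ge0 H); lia.
- by apply: (below_suffix_ge0 H); lia.
have := @below_total _ _ _ _ _ _ _ H t; rewrite (@below_cat _ _ _ 1 p); last by lia.
rewrite (@below_cat _ _ _ p p.+1) ?h0; rewrite /t; lia.
Qed.

Let L := below A n o.+1 1 x.
Let M := below A n o.+1 x.+1 y.
Let B := below A n o.+1 y.+1 z.
Let Q := below A n o.+1 z.+1 n.+1.

(** Below the closing row, columns [x] and [z] contribute 0 and column [y] contributes 1, whence the
    total [n - o - 2]. The [+ 1] in the entries of the opening row comes from the closing row, which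
    has one 1 on each side of [y]. *)
Lemma neutral_values :
  [/\ [/\ ainv n A (n - o) = L, ainv n A (n.+1 - o) = (L + M + 1)%R,
          cval n A = B & lval n A = M],
      [/\ ainv n (bar n A) (n - o) = Q, ainv n (bar n A) (n.+1 - o) = (Q + B + 1)%R,
          cval n (bar n A) = M & lval n (bar n A) = B],
      [/\ 0 <= L, 0 <= M, 0 <= B & 0 <= Q]%R &
      (L + M + B + Q = Posz (n - o) - 2)%R].
Proof.
have hL : (0 <= L)%R by apply: (below_ge0 H); lia.
have hM : (0 <= M)%R by apply: (below_ge0 H); lia.
have hB : (0 <= B)%R by apply: (below_ge0 H); lia.
have hQ : (0 <= Q)%R by apply: (below_ge0 H); lia.
have cx : below A n o.+1 x x.+1 = 0%R.
  by rewrite below_col; apply: (col_below0 H); rewrite ?(asm_rx H) // /inr; lia.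
have cz : below A n o.+1 z z.+1 = 0%R.
  by rewrite below_col; apply: (col_below0 H); rewrite ?(asm_rz H) // /inr; lia.
have cy : below A n o.+1 y y.+1 = 1%R by rewrite below_col (asm_coly H).
have ly : below A n o.+1 1 y = (L + M)%R.
  rewrite (@below_cat _ _ _ _ x); last by lia.
  by rewrite (@below_cat _ _ _ x x.+1) ?cx -/L -/M; lia.
have tot : (L + M + B + Q = Posz (n - o) - 2)%R.
  have := @below_total _ _ _ _ _ _ _ H o.+1.
  rewrite (@below_cat _ _ _ _ y) ?ly; last by lia.
  rewrite (@below_cat _ _ _ y y.+1) ?cy; last by lia.
  rewrite (@below_cat _ _ _ y.+1 z) -/B; last by lia.
  by rewrite (@below_cat _ _ _ z z.+1) ?cz -/Q; lia.
have ak : ainv n A (n.+1 - o) = (L + M + 1)%R.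
  rewrite (ainvE H); try by rewrite /inr; lia.
  have -> : (n.+1 - (n.+1 - o) = o)%N by lia.
  rewrite (one_col_op H) below_recl ?ly; last by lia.
  suff -> : nsum (A o.+1) 1 y = 1%R by rewrite addrC.
  have hrr : inr n o.+1 by rewrite /inr; lia.
  have := @asm_rowp _ _ _ _ _ _ _ H o.+1 y hrr.
  have := @asm_rowp _ _ _ _ _ _ _ H o.+1 y.+1 hrr.
  by rewrite nsum_recr ?(asm_ry H); lia.
have En : (n - o = n.+1 - o.+1)%N by lia.
split=> //; split=> //.
- by rewrite En (ainv_clE H).
- exact: cvalE H.
- exact: lvalE H erefl.
- rewrite En (ainv_clE H') below_bar; try lia.
  by rewrite /Q; congr below; lia.
- by have [||_ _] := ainv_bar (i := n.+1 - o); rewrite /inr ?ak; lia.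
- rewrite (cvalE H') below_bar; try lia.
  by rewrite /M; congr below; lia.
- rewrite (lvalE H') // below_bar; try lia.
  by rewrite /B; congr below; lia.
Qed.

Lemma Phi_bar_dual (E E' : int) : E' = (- E)%R -> (- lval n A <= E <= cval n A)%R ->
  is_dual n (Phi n A E) (Phi n (bar n A) E').
Proof.
move=> hE'; have tnK (u : int) : (0 <= u)%R -> Posz (tn u) = u by case: u.
have [[aL aM cB lM] [aQ aB cM lB] [hL hM hB hQ] tot] := neutral_values.
rewrite (Phi_config _ H) (Phi_config _ H').
rewrite lM cB => hE; rewrite cM lB.
have Ek : (n.+1 - o).-1 = (n - o)%N by lia.
have T1 : Posz (tn (ainv n A (n - o)%N)) = L by rewrite aL tnK.
have T2 : Posz (tn (ainv n A (n.+1 - o)%N)) = (L + M + 1)%R by rewrite aM tnK; lia.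
have T3 : Posz (tn (ainv n (bar n A) (n - o)%N)) = Q by rewrite aQ tnK.
have T4 : Posz (tn (ainv n (bar n A) (n.+1 - o)%N)) = (Q + B + 1)%R by rewrite aB tnK; lia.
have T5 := tnK B hB; have T6 := tnK M hM.
(* The two bounds on [E] serve here: [tn] truncates neither exponent [beta], by [- M <= E] for [A]
   and by [E <= B] for its reflection. *)
have T7 : Posz (tn (E + M)%R) = (E + M)%R by rewrite tnK; lia.
have T8 : Posz (tn (E' + B)%R) = (E' + B)%R by rewrite tnK; lia.
apply: config_dual; rewrite ?Ek; try lia.
- split; rewrite ?Ek; try lia.
  move=> i hi hik; have [h1 h2 h3] := ainv_bar hi hik.
  by have := tnK _ h1; move: hi; rewrite /inr; lia.
- split; rewrite ?Ek; try lia.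
  move=> i hi hik; have [h1 h2 h3] := ainv_bar hi hik.
  by have := tnK _ h2; move: hi; rewrite /inr; lia.
move=> i hi hik; have [h1 h2 h3] := ainv_bar hi hik.
by have := tnK _ h1; have := tnK _ h2; lia.
Qed.

End Neutral.

(** * Displacements and [delta] depend only on the entries in range *)

(** Characterizes the last nonzero column before a given one, from which [Hdisp] copies. *)
Lemma last_filter_iota (P : pred nat) m p : (0 < p <= m)%N -> P p ->
  let s := [seq j <- iota 1 m | P j] in
  [/\ s != [::], (0 < last 0%N s <= m)%N, P (last 0%N s) &
      forall q, (last 0%N s < q <= m)%N -> ~~ P q].
Proof.
move=> /= hp Pp; have hs m' : [seq j <- iota 1 m'.+1 | P j] =
    [seq j <- iota 1 m' | P j] ++ (if P m'.+1 then [:: m'.+1] else [::]).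
  by rewrite -{1}[m'.+1]addn1 iotaD filter_cat /= add1n.
elim: m hp => [|m IH] hp; first by lia.
rewrite hs; case: ifP => Pm.
  rewrite last_cat /=; split=> //; [by case: (filter _ _)|by move=> q; lia].
have [|h1 h2 h3 h4] := IH; first by have : p <> m.+1 by [move=> E; rewrite -E Pp in Pm]; lia.
rewrite cats0; split=> //; first by lia.
move=> q hq; have [->|hqm] := eqVneq q m.+1; first by rewrite Pm.
by apply: h4; lia.
Qed.

Lemma eq_Hdisp m q P Q : (forall i j, inr m i -> inr q j -> P i j = Q i j) ->
  forall i j, inr m i -> inr q j -> Hdisp m q P i j = Hdisp m q Q i j.
Proof.
move=> E i j hi hj; have Ec c : inr q c -> colnz m P c = colnz m Q c.
  by move=> hc; apply: eq_in_has => r; rewrite mem_iota => hr; rewrite E // /inr; lia.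
rewrite /Hdisp Ec //.
have -> : [seq c <- iota 1 j.-1 | colnz m P c] = [seq c <- iota 1 j.-1 | colnz m Q c].
  apply: eq_in_filter => c; rewrite mem_iota => hc; apply: Ec.
  by move: hj; rewrite /inr; lia.
case: ifP => // /andP[_ hs]; apply: E => //.
have : last 0%N [seq c <- iota 1 j.-1 | colnz m Q c] \in
         [seq c <- iota 1 j.-1 | colnz m Q c].
  by case: [seq _ <- _ | _] hs => //= ? ? _; apply: mem_last.
by rewrite mem_filter mem_iota => /andP[_]; move: hj; rewrite /inr; lia.
Qed.

Lemma eq_Vdisp m q P Q : (forall i j, inr m i -> inr q j -> P i j = Q i j) ->
  forall i j, inr m i -> inr q j -> Vdisp m q P i j = Vdisp m q Q i j.
Proof.
move=> E i j hi hj; have Er r : inr m r -> rownz q P r = rownz q Q r.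
  by move=> hr; apply: eq_in_has => c; rewrite mem_iota => hc; rewrite E // /inr; lia.
rewrite /Vdisp Er //.
have -> : [seq r <- iota i.+1 (m - i) | rownz q P r] =
          [seq r <- iota i.+1 (m - i) | rownz q Q r].
  apply: eq_in_filter => r; rewrite mem_iota => hr; apply: Er.
  by move: hi; rewrite /inr; lia.
case: ifP => // /andP[_ hs]; apply: E => //.
have : head 0%N [seq r <- iota i.+1 (m - i) | rownz q Q r] \in
         [seq r <- iota i.+1 (m - i) | rownz q Q r].
  by case: [seq _ <- _ | _] hs => //= ? ? _; apply: mem_head.
by rewrite mem_filter mem_iota => /andP[_]; move: hi; rewrite /inr; lia.
Qed.

Lemma eq_replace n A B r0 c0 m q P Q : mat_eq n A B ->
  (forall i j, inr m i -> inr q j -> P i j = Q i j) ->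
  mat_eq n (replace A r0 c0 m q P) (replace B r0 c0 m q Q).
Proof.
move=> EA EP i j hi hj; rewrite /replace; case: ifP => hij; last exact: EA.
by apply: EP; rewrite /inr; lia.
Qed.

Lemma eq_subm n A B r0 c0 m q : mat_eq n A B ->
  (0 < r0)%N -> (0 < c0)%N -> (r0 + m <= n.+1)%N -> (c0 + q <= n.+1)%N ->
  forall i j, inr m i -> inr q j -> subm A r0 c0 i j = subm B r0 c0 i j.
Proof. by move=> E ? ? ? ? i j; rewrite /inr /subm => ? ?; apply: E; rewrite /inr; lia. Qed.

Lemma eq_delta n A B r y o x z : mat_eq n A B -> asm1 n A r y o x z ->
  mat_eq n (delta n A) (delta n B).
Proof.
move=> E H; have H' := asm1_eq E H; rewrite /delta.
have := asm_o H; have := asm_r H; have := asm_x H; have := asm_z H => hz hx hr ho.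
rewrite (asm1_cl_row H) (asm1_cl_row H') (asm1_op_col H) (asm1_op_col H').
rewrite (asm1_op_row H) (asm1_op_row H') (asm1_cl_col H) (asm1_cl_col H').
set A1 : mat := fun i j => if (i == r) && ((j == y) || (j == z)) then 0%R else A i j.
set B1 : mat := fun i j => if (i == r) && ((j == y) || (j == z)) then 0%R else B i j.
have E1 : mat_eq n A1 B1 by move=> i j hi hj; rewrite /A1 /B1 E.
set A2 := replace A1 _ _ _ _ _; set B2 := replace B1 _ _ _ _ _.
have E2 : mat_eq n A2 B2.
  by apply: eq_replace => //; apply: eq_Hdisp; apply: (eq_subm E1); lia.
set A3 := replace A2 _ _ _ _ _; set B3 := replace B2 _ _ _ _ _.
have E3 : mat_eq n A3 B3.
  by apply: eq_replace => //; apply: eq_Vdisp; apply: (eq_subm E2); lia.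
(* Lowering reads row [i.-1], which is still in range because it is read only below the opening
   row. *)
move=> i j hi hj; have E3' : (o < i)%N -> A3 i.-1 j = B3 i.-1 j.
  by move=> hoi; apply: E3 => //; move: hi; rewrite /inr; lia.
rewrite (E3 i j hi hj); case: ifP => _.
  by case: ifP => // _; case: ifP => // hoi; rewrite E3' //; lia.
case: ifP => // _; case: ifP => // _; case: ifP => // hoi; rewrite E3' //; lia.
Qed.

(** * The effect of [delta] on a neutral matrix *)

Definition colsum (n r : nat) (A : mat) (j : nat) : int := nsum (A^~ j) r.+1 n.+1.

Section NeutralDelta.
Variables (n : nat) (A : mat) (y o x z : nat).
Hypothesis H : asm1 n A o.+1 y o x z.

Let ho := asm_o H.
Let hr := asm_r H.
Let hx := asm_x H.
Let hz := asm_z H.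
Let D := delta n A.
Let r := o.+1.

Let A1 : mat := fun i j => if (i == r) && ((j == y) || (j == z)) then 0%R else A i j.
Let A2 := replace A1 r.+1 y (n - r) (z - y).+1
            (Hdisp (n - r) (z - y).+1 (subm A1 r.+1 y)).
Let A3 := replace A2 o 1 2 y.-1 (Vdisp 2 y.-1 (subm A2 o 1)).

(** Without enclosed rows the extended neutral cell consists of the two rows [o] and [r], and the
    lowering on the right side only clears row [r]. *)
Lemma delta_neutralE i j : D i j =
  if (j < y)%N then (if i == o then 0%R else if i == r then A3 o j else A3 i j)
  else if (y < j)%N then (if i == r then 0%R else A3 i j)
  else A3 i j.
Proof.
rewrite /D /delta (asm1_cl_row H) (asm1_op_col H) (asm1_op_row H) (asm1_cl_col H).
rewrite subSnn -/A1 -/A2 -/A3 /r; case: (ltnP j y) => _.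
  case: (i =P o) => // hio; case: (i =P o.+1) => [->|hir]; first by rewrite ltnSn.
  by have -> : (o < i <= o.+1)%N = false by lia.
case: ltnP => // _; case: (i =P o.+1) => // hir.
by have -> : (o.+1 < i <= o.+1)%N = false by lia.
Qed.

Lemma delta_above i j : inr n j -> (i < o)%N -> D i j = A i j.
Proof.
move=> hj hi; rewrite delta_neutralE /A3 /A2 /A1 /replace.
have -> : (i == o) = false by lia.
have -> : (i == r) = false by rewrite /r; lia.
have -> : (o <= i < o + 2)%N = false by lia.
have -> : (r < i < r.+1 + (n - r))%N = false by rewrite /r; lia.
by do 2?case: ifP.
Qed.

(** Lowering clears the left part of this row and leaves column [y] alone, so [y] can be read off
    [delta] as the first nonzero column of row [o]. *)
Lemma delta_op_row j : (j <= y)%N -> D o j = if j == y then 1%R else 0%R.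
Proof.
move=> hj; rewrite delta_neutralE /A3 /A2 /A1 /replace eqxx.
case: (j =P y) => [->|hjy]; last by have -> : (j < y)%N by lia.
rewrite ltnn; have -> : (1 <= y < 1 + y.-1)%N = false by lia.
rewrite andbF; have -> : (r < o < r.+1 + (n - r))%N = false by rewrite /r; lia.
by have -> : (o == r) = false by [rewrite /r; lia]; rewrite /= (asm_oy H).
Qed.

(** [Vdisp] lifts the left part of the closing row to the opening row, and lowering brings it
    back. *)
Lemma delta_cl_row j : (0 < j < y)%N -> D r j = A r j.
Proof.
move=> hj; rewrite delta_neutralE; have -> : (j < y)%N by lia.
have -> : (r == o) = false by rewrite /r; lia.
have E2 c : (0 < c < y)%N -> subm A2 o 1 2 c = A r c.
  move=> hc; rewrite /subm /A2 /replace /A1.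
  have -> : (2 + o - 1 = r)%N by rewrite /r; lia.
  rewrite ltnn eqxx /= addnK.
  by have -> : (c == y) || (c == z) = false by lia.
rewrite eqxx /A3 /replace; have -> : (o <= o < o + 2)%N && (1 <= j < 1 + y.-1)%N by lia.
have -> : (o - o + 1 = 1)%N by lia.
have -> : (j - 1 + 1 = j)%N by lia.
rewrite /Vdisp /=.
(* The 1 in column [x] makes row 2 of the cell nonzero, so it is the row that [Vdisp] moves to row
   1. *)
have -> : rownz y.-1 (subm A2 o 1) 2.
  by apply/hasP; exists x; rewrite ?mem_iota ?E2 ?(asm_rx H); lia.
by rewrite /= E2.
Qed.

Lemma delta_below_out i j : inr n j -> (r < i <= n)%N -> (j < y)%N || (z < j)%N ->
  D i j = A i j.
Proof.
move=> hj hi hjyz; rewrite delta_neutralE /A3 /A2 /A1 /replace.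
have -> : (i == o) = false by move: hi; rewrite /r; lia.
have -> : (i == r) = false by lia.
have -> : (o <= i < o + 2)%N = false by move: hi; rewrite /r; lia.
have -> : (y <= j < y + (z - y).+1)%N = false by lia.
by rewrite andbF; do 2?case: ifP.
Qed.

Lemma delta_below_in i j : (r < i <= n)%N -> (y <= j <= z)%N ->
  D i j = Hdisp (n - r) (z - y).+1 (subm A1 r.+1 y) (i - r) (j - y).+1.
Proof.
move=> hi hj; rewrite delta_neutralE /A3 /A2 /replace.
have -> : (j < y)%N = false by lia.
have -> : (i == r) = false by lia.
have -> : (o <= i < o + 2)%N = false by move: hi; rewrite /r; lia.
have -> : (r < i < r.+1 + (n - r))%N && (y <= j < y + (z - y).+1)%N by lia.
have -> : (i - r.+1 + 1 = i - r)%N by lia.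
by have -> : (j - y + 1 = (j - y).+1)%N by [lia]; case: ifP.
Qed.

Lemma submE i b : (0 < i)%N -> (0 < b)%N ->
  subm A1 r.+1 y i b = A (i + r)%N (b + y - 1)%N.
Proof.
move=> hi hb; rewrite /subm /A1; have -> : (i + r.+1 - 1 = i + r)%N by lia.
by have -> : (i + r == r)%N = false by lia.
Qed.

Lemma entry_below_ge0 i j : (r < i <= n)%N -> inr n j -> (0 <= A i j)%R.
Proof. by move=> hi hj; apply: (asm_ge0 H) => //; rewrite ?/inr -/r; lia. Qed.

Lemma colsum_01 j : inr n j -> colsum n r A j = 0%R \/ colsum n r A j = 1%R.
Proof.
move=> hj; rewrite /colsum; have [->|hjy] := eqVneq j y; first by right; apply: asm_coly H.
have h0 : (0 <= nsum (A^~ j) r.+1 n.+1)%R.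
  by apply: nsum_ge0 => i hi; apply: entry_below_ge0; rewrite // ; lia.
have := @asm_col _ _ _ _ _ _ _ H j hj; rewrite (@nsum_cat _ r.+1); last by rewrite /r; lia.
have : (0 <= nsum (A^~ j) 1 r.+1)%R.
  by apply: nsum_ge0 => i hi; apply: (asm_ge0 H); rewrite ?hjy ?orbT // /inr; move: hi; rewrite /r; lia.
lia.
Qed.

Lemma colsum_eq0 i j : (r < i <= n)%N -> inr n j -> colsum n r A j = 0%R -> A i j = 0%R.
Proof.
move=> hi hj h; have := entry_below_ge0 hi hj.
have := @nsum_ge (A^~ j) r.+1 n.+1 i; rewrite -/(colsum n r A j) h => h1.
suff : (A i j <= 0)%R by lia.
by apply: h1 => // i' hi'; apply: entry_below_ge0; lia.
Qed.

Lemma colsum_z : colsum n r A z = 0%R.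
Proof.
by apply: (col_below0 H); rewrite ?(asm_rz H) // /inr /r; lia.
Qed.

(** Replaces the nonzero test of [Hdisp] by a column sum, which can be compared between a matrix and
    its image under [delta]. *)
Lemma colnz_colsum b : (0 < b)%N -> (b + y - 1 <= n)%N ->
  colnz (n - r) (subm A1 r.+1 y) b = (colsum n r A (b + y - 1) == 1%R).
Proof.
move=> hb hbn; have hj : inr n (b + y - 1) by rewrite /inr; lia.
apply/hasP/eqP => [[i]|hs].
  rewrite mem_iota => hi; rewrite submE; [|lia|lia] => /eqP Ai.
  case: (colsum_01 hj) => // h0; case: Ai; apply: (colsum_eq0 _ hj h0); lia.
have [|i hi Ai] := @nsum_neq0 (A^~ (b + y - 1)%N) r.+1 n.+1.
  by rewrite -/(colsum n r A _) hs.
exists (i - r)%N; first by rewrite mem_iota; lia.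
rewrite submE; [|lia|lia]; have -> : (i - r + r = i)%N by lia.
exact/eqP.
Qed.

(** The displacement seen from its target [j], whose source is [j0]. A source exists because column
    [y], the first of the cell, is nonzero below the closing row. *)
Lemma delta_pull j : (y < j <= z)%N -> j = z \/ colsum n r A j = 1%R ->
  exists2 j0, [/\ (y <= j0 < j)%N, colsum n r A j0 = 1%R &
                 forall j1, (j0 < j1 < j)%N -> colsum n r A j1 = 0%R] &
    forall i, (r < i <= n)%N -> D i j = A i j0.
Proof.
move=> hj hjz; pose P := colnz (n - r) (subm A1 r.+1 y).
have P1 : P 1%N.
  rewrite /P colnz_colsum; try lia.
  have -> : (1 + y - 1 = y)%N by lia.
  by apply/eqP; exact: asm_coly H.
have [|s0 sl Ps smax] := @last_filter_iota P (j - y) 1 _ P1; first by lia.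
set s := [seq _ <- _ | _] in s0 sl Ps smax; set l := last 0%N s in sl Ps smax.
have Pc b : (0 < b <= j - y)%N -> P b = (colsum n r A (b + y - 1) == 1%R).
  by move=> hb; rewrite /P colnz_colsum; lia.
exists (l + y - 1)%N; first split; first by lia.
- by apply/eqP; rewrite -Pc.
- move=> j1 hj1; have [|//|h1] := @colsum_01 j1; first by rewrite /inr; lia.
  have := smax (j1 - y).+1; rewrite Pc; last by lia.
  by have -> : ((j1 - y).+1 + y - 1 = j1)%N by [lia]; rewrite h1 eqxx => h; have := h _; lia.
move=> i hi; rewrite delta_below_in //; last by lia.
rewrite /Hdisp -/P [_.+1.-1]/= -/s s0 andbT.
have -> : ((j - y).+1 == (z - y).+1) || P (j - y).+1.
  case: hjz => [->|h1]; first by rewrite eqxx.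
  rewrite /P colnz_colsum; try lia.
  by have -> : ((j - y).+1 + y - 1 = j)%N by [lia]; rewrite h1 eqxx orbT.
by rewrite submE; [|lia|lia]; rewrite subnK //; lia.
Qed.

Lemma delta_zero i j : (y < j < z)%N -> colsum n r A j = 0%R -> (r < i <= n)%N -> D i j = 0%R.
Proof.
move=> hj hs hi; rewrite delta_below_in //; last by lia.
rewrite /Hdisp colnz_colsum; try lia.
have -> : ((j - y).+1 + y - 1 = j)%N by lia.
rewrite hs; have -> : ((j - y).+1 == (z - y).+1) = false by lia.
by [].
Qed.

(** Strictly inside the cell, a nonzero column is overwritten by another nonzero column and a zero
    column stays zero. *)
Lemma colsum_delta j : (y < j < z)%N -> colsum n r D j = colsum n r A j.
Proof.
move=> hj; have [|h0|h1] := @colsum_01 j; first by rewrite /inr; lia.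
  by rewrite h0; apply: nsum0 => i hi; apply: delta_zero; lia.
have [||j0 [_ h2 _] hD] := @delta_pull j; [lia|by right|].
by rewrite h1 -h2; apply: eq_nsum => i hi; apply: hD; lia.
Qed.

Lemma colsum_delta_z : colsum n r D z = 1%R.
Proof.
have [||j0 [_ h2 _] hD] := @delta_pull z; [lia|by left|].
by rewrite -h2; apply: eq_nsum => i hi; apply: hD; lia.
Qed.

(** Expresses [cval] by the image alone, given [y] and [z]. Column [z] itself, of sum 1 in the
    image, is just excluded, which is what lets [cval] detect [z]. *)
Lemma cval_delta : cval n A = nsum (colsum n r D) y.+1 z.
Proof.
rewrite (cvalE H) /below nsum_exchange; apply: eq_nsum => j hj.
by rewrite colsum_delta //; lia.
Qed.

(** The displacement seen from its source [j]. The target [j'] is described by column sums of the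
    image only, so the original column can be read back from [delta]. *)
Lemma delta_push j : (y <= j < z)%N -> colsum n r A j = 1%R ->
  exists2 j', [/\ (j < j' <= z)%N, colsum n r D j' = 1%R &
                 forall j1, (j < j1 < j')%N -> colsum n r D j1 = 0%R] &
    forall i, (r < i <= n)%N -> D i j' = A i j.
Proof.
(* [Q] marks the columns beyond [j] that [Hdisp] fills; the least of them receives column [j]. *)
move=> hj hs; pose Q j' := (j < j')%N && ((j' == z) || (colsum n r A j' == 1%R)).
have exQ : exists j', Q j' by exists z; rewrite /Q eqxx; lia.
case: (ex_minnP exQ) => j' /andP[hjj' Qj'] minj'.
have hj'z : (j' <= z)%N by apply: minj'; rewrite /Q eqxx; lia.
have hbetween j1 : (j < j1 < j')%N -> colsum n r A j1 = 0%R.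
  move=> hj1; have [|//|h1] := @colsum_01 j1; first by rewrite /inr; lia.
  by have := minj' j1; rewrite /Q h1 eqxx orbT; lia.
have [||j0 [hj0 s0 between0] hD] := @delta_pull j'; first by lia.
  by case/orP: Qj' => /eqP; [left|right].
have Ej : j0 = j.
  have [lt|gt|//] := ltngtP j0 j.
    by have := between0 j; rewrite hs => h; have := h _; lia.
  by have := hbetween j0; rewrite s0 => h; have := h _; lia.
exists j'; last by move=> i hi; rewrite hD // Ej.
split; first by lia.
- case: (eqVneq j' z) => [->|Nz]; first exact: colsum_delta_z.
  rewrite colsum_delta; last by lia.
  by case/orP: Qj' => /eqP // Ez; rewrite Ez eqxx in Nz.
- by move=> j1 hj1; rewrite colsum_delta ?hbetween //; lia.
Qed.

End NeutralDelta.

(** * Injectivity of [delta] on neutral matrices *)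

Lemma delta_op_col_le n A B y o x z y' x' z' :
  asm1 n A o.+1 y o x z -> asm1 n B o.+1 y' o x' z' ->
  mat_eq n (delta n A) (delta n B) -> (y <= y')%N.
Proof.
move=> HA HB E; have := asm_x HA; have := asm_z HA; have := asm_o HA; have := asm_r HA.
move=> ? ? ? ?; have := asm_x HB => ?; rewrite leqNgt; apply/negP => lt.
have := E o y'; rewrite (delta_op_row HA) ?(delta_op_row HB) ?eqxx; try lia.
by have -> : (y' == y) = false by [lia]; rewrite /inr => h; have := h _ _; lia.
Qed.

(** If [z' < z], the sum giving [cval n A] includes column [z'], where the common image has sum 1,
    and so exceeds the sum giving [cval n B]. *)
Lemma delta_cl_col_le n A B y o x z x' z' :
  asm1 n A o.+1 y o x z -> asm1 n B o.+1 y o x' z' ->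
  mat_eq n (delta n A) (delta n B) -> cval n A = cval n B -> (z <= z')%N.
Proof.
move=> HA HB E; have := asm_z HA; have := asm_x HA; have := asm_r HA; have := asm_z HB.
move=> hz' hr hx hz; rewrite leqNgt (cval_delta HA) (cval_delta HB) => Ec; apply/negP => lt.
have Es j : inr n j -> colsum n o.+1 (delta n A) j = colsum n o.+1 (delta n B) j.
  by move=> hj; apply: eq_nsum => i hi; apply: E => //; rewrite /inr; lia.
move: Ec; rewrite (@nsum_cat _ z') ?(@nsum_recl _ z'); try lia.
rewrite (@eq_nsum _ (colsum n o.+1 (delta n B)) y.+1 z'); last first.
  by move=> j hj; apply: Es; rewrite /inr; lia.
rewrite Es ?(colsum_delta_z HB); last by rewrite /inr; lia.
suff : (0 <= nsum (colsum n o.+1 (delta n A)) z'.+1 z)%R by lia.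
apply: nsum_ge0 => j hj; rewrite (colsum_delta HA); last by lia.
by have [|->|->] := @colsum_01 _ _ _ _ _ _ HA j; rewrite /inr //; lia.
Qed.

Lemma delta_neutral_inj n A B y o x z y' x' z' :
  asm1 n A o.+1 y o x z -> asm1 n B o.+1 y' o x' z' ->
  mat_eq n (delta n A) (delta n B) -> cval n A = cval n B -> mat_eq n A B.
Proof.
move=> HA HB E Ec; have E' : mat_eq n (delta n B) (delta n A).
  by move=> i j hi hj; rewrite E.
have Ey : y' = y.
  have := delta_op_col_le HA HB E; have := delta_op_col_le HB HA E'; lia.
move: HB; rewrite {y'}Ey => HB.
have Ez : z' = z.
  have := delta_cl_col_le HA HB E Ec; have := delta_cl_col_le HB HA E' (esym Ec); lia.
move: HB; rewrite {z'}Ez => HB.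
have := asm_z HA; have := asm_x HA; have := asm_x HB; have := asm_r HA; have := asm_o HA.
move=> ho hr hx' hx hz i j hi hj; move: (hi) (hj); rewrite {1 2}/inr => hi' hj'.
have [lt|ge] := ltnP i o.
  by rewrite -(delta_above HA) // -(delta_above HB) // E.
have [Ei|Nio] := eqVneq i o.
  have io : inr n o by rewrite -Ei.
  have Nor : o != o.+1 by lia.
  have [_ _] := asm1_one_col HA io Nor; have [_ _] := asm1_one_col HB io Nor.
  rewrite Ei (one_col_op HA) (one_col_op HB) => hB hA.
  have [->|Njy] := eqVneq j y; first by rewrite (asm_oy HA) (asm_oy HB).
  by rewrite hA ?hB.
have [Ei|Nir] := eqVneq i o.+1.
  rewrite Ei in hi *; have [lt|gt|->] := ltngtP j y; last by rewrite (asm_ry HA) (asm_ry HB).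
    by rewrite -(delta_cl_row HA) -?(delta_cl_row HB) ?E //; lia.
  have [->|Njz] := eqVneq j z; first by rewrite (asm_rz HA) (asm_rz HB).
  by rewrite (asm_row0 HA) ?(asm_row0 HB) //; lia.
have hir : (o.+1 < i <= n)%N by lia.
have [hout|hin] := boolP ((j < y) || (z < j))%N.
  by rewrite -(delta_below_out HA) // -(delta_below_out HB) // E.
(* Column [z] is empty below the closing row, so [Hdisp] loses nothing by overwriting it. *)
have [->|Njz] := eqVneq j z.
  have iz : inr n z by rewrite /inr; lia.
  rewrite (colsum_eq0 HA hir iz (colsum_z HA)).
  by rewrite (colsum_eq0 HB hir iz (colsum_z HB)).
have Es j1 : inr n j1 -> colsum n o.+1 (delta n A) j1 = colsum n o.+1 (delta n B) j1.
  by move=> hj1; apply: eq_nsum => i1 hi1; apply: E => //; rewrite /inr; lia.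
have Ecs : colsum n o.+1 A j = colsum n o.+1 B j.
  have [->|Njy] := eqVneq j y; first by rewrite /colsum (asm_coly HA) (asm_coly HB).
  by rewrite -(colsum_delta HA) -?(colsum_delta HB) ?Es //; lia.
have [h0|h1] := colsum_01 HA hj.
  by rewrite (colsum_eq0 HA hir hj h0) (colsum_eq0 HB hir hj) // -Ecs.
have hjz : (y <= j < z)%N by lia.
(* Column [j] is followed to its target in each image; the common column sums force the two targets
   to agree. *)
have [a [ha sa ba] DA] := delta_push HA hjz h1.
have [b [hb sb bb] DB] : exists2 j', [/\ (j < j' <= z)%N,
    colsum n o.+1 (delta n B) j' = 1%R &
    forall j1, (j < j1 < j')%N -> colsum n o.+1 (delta n B) j1 = 0%R] &
    forall i, (o.+1 < i <= n)%N -> delta n B i j' = B i j.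
  by apply: (delta_push HB hjz); rewrite -Ecs.
have ia : inr n a by rewrite /inr; lia.
have Eab : a = b.
  have [lt|gt|//] := ltngtP a b.
    by have := bb a; rewrite -Es // sa => h; have := h _; lia.
  have ib : inr n b by rewrite /inr; lia.
  by have := ba b; rewrite Es // sb => h; have := h _; lia.
by rewrite -DA // -DB // -Eab E.
Qed.

(** * Compatibility with [mat_eq], and uniqueness of the output of [Lambda] *)

Lemma barK n A : mat_eq n (bar n (bar n A)) A.
Proof. by move=> i j _; rewrite /inr /bar => hj; congr A; lia. Qed.

Lemma eq_one_col n A B i : mat_eq n A B -> inr n i -> one_col n A i = one_col n B i.
Proof.
move=> E hi; apply: eq_in_first_in => j; rewrite mem_iota => hj.
by rewrite E // /inr; lia.
Qed.

Lemma eq_cell_sum n A B r1 r2 c1 c2 : mat_eq n A B -> (0 < r1)%N -> (0 < c1)%N ->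
  (r2 <= n)%N -> (c2 <= n)%N -> cell_sum A r1 r2 c1 c2 = cell_sum B r1 r2 c1 c2.
Proof.
move=> E ? ? ? ?; rewrite !cell_sumE; apply: eq_nsum => i hi; apply: eq_nsum => j hj.
by apply: E; rewrite /inr; lia.
Qed.

Lemma eq_Phi n A B y o x z E : mat_eq n A B -> asm1 n A o.+1 y o x z ->
  Phi n A E = Phi n B E.
Proof.
move=> EAB H; have H' := asm1_eq EAB H.
have := asm_z H; have := asm_x H; have := asm_r H; have := asm_o H => ? ? ? ?.
have Eb t c d : (0 < c)%N -> (d <= n.+1)%N -> below A n t c d = below B n t c d.
  move=> ? ?; apply: eq_nsum => i hi; apply: eq_nsum => j hj.
  by apply: EAB; rewrite /inr; lia.
have Ea i : inr n i -> ainv n A i = ainv n B i.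
  rewrite /inr => hi; have [Ei|Ni] := eqVneq (n.+1 - i)%N o.+1.
    have -> : i = (n.+1 - o.+1)%N by lia.
    by rewrite (ainv_clE H) (ainv_clE H') Eb //; lia.
  have ht : inr n (n.+1 - i) by rewrite /inr; lia.
  rewrite (ainvE H) // (ainvE H') // (eq_one_col EAB ht).
  by have [/andP[_ ?] _ _] := asm1_one_col H' ht Ni; rewrite Eb //; lia.
rewrite (Phi_config _ H) (Phi_config _ H') (cvalE H) (cvalE H') (lvalE H) // (lvalE H') //.
rewrite !Eb; try lia.
apply/eq_in_map => i; rewrite mem_iota => hi.
by rewrite /left_word /right_word !Ea // /inr; lia.
Qed.

Lemma eq_cval n A B r y o x z : mat_eq n A B -> asm1 n A r y o x z -> cval n A = cval n B.
Proof.
move=> E H; have H' := asm1_eq E H; have := asm_z H => ?.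
rewrite /cval (asm1_cl_row H) (asm1_cl_row H') (asm1_op_col H) (asm1_op_col H').
by rewrite (asm1_cl_col H) (asm1_cl_col H'); apply: (eq_cell_sum E) => //; lia.
Qed.

Lemma eq_Echg n A B r y o x z : mat_eq n A B -> asm1 n A r y o x z -> Echg n A = Echg n B.
Proof.
move=> E H; have H' := asm1_eq E H; rewrite /Echg /is_positive.
rewrite (asm1_cl_row H) (asm1_cl_row H') (asm1_op_col H) (asm1_op_col H').
rewrite (asm1_op_row H) (asm1_op_row H').
have := asm_o H; have := asm_r H => ? ?.
rewrite (eq_one_col (i := r.-1) E); last by rewrite /inr; lia.
by case: ifP => // _; apply: (eq_cell_sum E) => //; lia.
Qed.

Lemma eq_Lambda_PN n A B N E r y o x z : mat_eq n A B -> asm1 n A r y o x z ->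
  Lambda_PN n A N E -> Lambda_PN n B N E.
Proof.
move=> EAB H [hN [EE [Eo [Ed [Ec E0]]]]]; have H' := asm1_eq EAB H.
rewrite /Lambda_PN -(eq_Echg EAB H) -(eq_cval EAB H); split=> //; split=> //.
split; first by rewrite Eo (asm1_op_row H) (asm1_op_row H').
by split=> // i j hi hj; rewrite Ed // (eq_delta EAB H).
Qed.

Lemma neutral_Echg n A y o x z : asm1 n A o.+1 y o x z -> Echg n A = 0%R.
Proof. by move=> H; rewrite /Echg /is_positive (asm1_cl_row H) (asm1_op_row H) ltnn. Qed.

Lemma Echg_ge0 n A r y o x z : asm1 n A r y o x z -> (0 <= Echg n A)%R.
Proof.
move=> H; rewrite /Echg; case: ifP => // _; rewrite (asm1_cl_row H) (asm1_op_row H).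
rewrite (asm1_op_col H) cell_sumE; have := asm_o H; have := asm_r H => ? ?.
apply: nsum_ge0 => i hi; apply: nsum_ge0 => j hj.
by apply: (asm_ge0 H); rewrite /inr; lia.
Qed.

(** The 1 of the lowest enclosed row lies in the charged cell, whose entries are nonnegative. *)
Lemma Echg_positive n A r y o x z : asm1 n A r y o x z -> is_positive n A ->
  (0 < Echg n A)%R.
Proof.
move=> H hp; rewrite /Echg hp; move: hp; rewrite /is_positive (asm1_cl_row H).
rewrite (asm1_op_row H) (asm1_op_col H) cell_sumE => /andP[hr hy].
have := asm_o H; have := asm_r H => ? ?.
have hi : inr n r.-1 by rewrite /inr; lia.
have hir : r.-1 != r by lia.
have [/andP[? ?] Ap _] := asm1_one_col H hi hir.
set p := one_col n A r.-1 in hy Ap *.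
have h0 i j : (o < i < r)%N -> (y < j < n.+1)%N -> (0 <= A i j)%R.
  by move=> ? ?; apply: (asm_ge0 H); rewrite /inr; lia.
apply: (@Order.POrderTheory.lt_le_trans _ _ (A r.-1 p)); first by rewrite Ap.
apply: (@Order.POrderTheory.le_trans _ _ (nsum (A r.-1) y.+1 n.+1)).
  by apply: nsum_ge => [j hj|]; [apply: h0|]; lia.
apply: (@nsum_ge (fun i => nsum (A i) y.+1 n.+1)); last by lia.
by move=> i hi1; apply: nsum_ge0 => j hj; apply: h0; lia.
Qed.

(** A positive [N] would have a positive charge, so [Echg n N = 0] forces neutrality. The range of
    [E] holds because [cval n N] is [E] plus the nonnegative [cval n A], while [E] and [lval n N]
    are nonnegative. *)
Lemma Lambda_PN_neutral n A N E r y o x z : asm1 n A r y o x z -> Lambda_PN n A N E ->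
  [/\ exists y' x' z', asm1 n N o.+1 y' o x' z', E = Echg n A,
      mat_eq n (delta n N) (delta n A), cval n N = (cval n A + Echg n A)%R &
      (- lval n N <= E <= cval n N)%R].
Proof.
move=> H [[/in_A1_asm1[r' [y' [o' [x' [z' HN]]]]] hPN] [EE [Eo [Ed [Ec E0]]]]].
have Eo' : o' = o by rewrite -(asm1_op_row HN) Eo (asm1_op_row H).
have Er : r' = o.+1.
  case/orP: hPN => [/(Echg_positive HN)|]; first by rewrite E0.
  by rewrite (asm1_is_neutral HN) Eo' => /eqP.
move: HN; rewrite {o'}Eo' {r'}Er => HN; split=> //; first by exists y', x', z'.
have := Echg_ge0 H; have := cval_ge0 H; rewrite Ec EE => h1 h2.
suff : (0 <= lval n N)%R by lia.
rewrite (lvalE HN) //; apply: (below_ge0 HN) => //.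
by have := asm_z HN; lia.
Qed.

Lemma Lambda_PN_unique n A N M E E1 r y o x z : asm1 n A r y o x z ->
  Lambda_PN n A N E -> Lambda_PN n A M E1 -> mat_eq n N M.
Proof.
move=> H /(Lambda_PN_neutral H)[[y1 [x1 [z1 HN]]] _ Ed Ec _].
move=> /(Lambda_PN_neutral H)[[y2 [x2 [z2 HM]]] _ Ed' Ec' _].
apply: (delta_neutral_inj HN HM); last by rewrite Ec Ec'.
by move=> i j hi hj; rewrite Ed // Ed'.
Qed.

Lemma Phi_dual n N N' (E E' : int) y o x z : asm1 n N o.+1 y o x z -> mat_eq n N' (bar n N) ->
  E' = (- E)%R -> (- lval n N <= E <= cval n N)%R -> is_dual n (Phi n N E) (Phi n N' E').
Proof.
move=> H EN EE hE; have EN' : mat_eq n (bar n N) N' by move=> i j hi hj; rewrite EN.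
by rewrite -(eq_Phi E' EN' (asm1_bar H)); exact: (Phi_bar_dual H EE hE).
Qed.

Theorem theorem5 (n : nat) (A N : mat) (E : int) (N' : mat) (E' : int) :
  in_A1 n A ->
  Lambda n A N E ->
  Lambda n (bar n A) N' E' ->
  is_dual n (Phi n N E) (Phi n N' E').
Proof.
case/in_A1_asm1 => r [y [o [x [z H]]]]; have H' := asm1_bar H.
have inr_bar j : inr n j -> inr n (n.+1 - j) by rewrite /inr; lia.
have bar_eq (B C : mat) : mat_eq n B C -> mat_eq n (bar n B) (bar n C).
  by move=> EBC i j hi hj; apply: EBC => //; apply: inr_bar.
rewrite /Lambda (asm1_is_negative_bar H).
have [[-> ->]|[-> ->]|[-> -> Er]] := asm1_trichotomy H.
(* Negative [A]: both outputs come from the positive matrix [bar n A], so [M] agrees with [N'], and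
   duality is applied from [bar n M]. *)
- case=> M [hM EN] hN'; have EM := Lambda_PN_unique H' hM hN'.
  have [[y1 [x1 [z1 HM]]] EE _ _ hE] := Lambda_PN_neutral H' hM.
  have [_ EE' _ _ _] := Lambda_PN_neutral H' hN'.
  have [[_ _ cm lm] [_ _ cb lb] _ _] := neutral_values HM.
  have EN2 : mat_eq n (bar n M) N by move=> i j hi hj; rewrite EN.
  rewrite -(eq_Phi E EN2 (asm1_bar HM)); apply: (Phi_dual (asm1_bar HM)).
  + by move=> i j hi hj; rewrite -EM // barK.
  + by rewrite EE' EE.
  (* Reflection exchanges [cval] and [lval], which turns the range of [- E] for [M] into that of [E]
     for [bar n M]. *)
  + by rewrite cb lb -cm -lm; move: hE; lia.
(* Positive [A]: on the reflection, [Lambda] goes through [bar n (bar n A)], which is [A] only up to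
   [mat_eq]. *)
- move=> hN [M [hM EN']]; move: hM => /(eq_Lambda_PN (@barK n A) (asm1_bar H')) hM.
  have EM := Lambda_PN_unique H hM hN.
  have [[y1 [x1 [z1 HN]]] EE _ _ hE] := Lambda_PN_neutral H hN.
  have [_ EE' _ _ _] := Lambda_PN_neutral H hM.
  apply: (Phi_dual HN) => //; last by rewrite EE -EE' opprK.
  by move=> i j hi hj; rewrite EN' // (bar_eq _ _ EM).
- move: H H'; rewrite {r}Er => H H' hN hN'.
  (* A neutral matrix is its own output: its charge is 0, so it shares [delta] and [cval] with any
     output. *)
  have self B y1 x1 z1 : asm1 n B o.+1 y1 o x1 z1 -> forall M e, Lambda_PN n B M e ->
      e = 0%R /\ mat_eq n M B.
    move=> HB M e /(Lambda_PN_neutral HB)[[y2 [x2 [z2 HM]]] -> Ed Ec _].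
    split; first exact: neutral_Echg HB.
    by apply: (delta_neutral_inj HM HB Ed); rewrite Ec (neutral_Echg HB) addr0.
  have [EE EN] := self _ _ _ _ H _ _ hN; have [EE' EN'] := self _ _ _ _ H' _ _ hN'.
  have [[y1 [x1 [z1 HN]]] _ _ _ hE] := Lambda_PN_neutral H hN.
  apply: (Phi_dual HN) => //; last by rewrite EE EE' oppr0.
  by move=> i j hi hj; rewrite EN' // (bar_eq _ _ EN).
Qed.
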